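(* Let $p$ be a prime and let $A$ be a multiplicative subgroup of $\mathbb Z_p^*$ such that $|A|\ll p^{\frac 23}$. Then $$E(A)\ll \max\left\{|A|^{\frac 43}|2A|^{\frac 23}\log^{\frac 12}(|A|),\ |A|\,|2A|^2p^{-1}\log(|A|)\right\}.$$
   Context: For subsets $A,B$ of $\mathbb Z_p$, $A+B=\{a+b:a\in A,b\in B\}$ and $2A=A+A$. The additive energy is $E(A)=|\{(x,y,z,w)\in A^4: x+y=z+w\}|=\sum_s |A\cap(A+s)|^2$. The notation $X\ll Y$ means $X\le CY$ for an absolute constant $C>0$.
   Formalization: The subgroup A is assumed nontrivial (|A| > 1), since for A = {1} the logarithms vanish, the right-hand side is 0 and E(A) = 1, so the stated inequality fails. *)

(* Defs.v *)
From HB Require Import structures.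
From mathcomp Require Import all_boot all_order all_algebra all_fingroup.
Set Implicit Arguments.
Unset Strict Implicit.
Unset Printing Implicit Defensive.
Import GRing.Theory.
Local Open Scope ring_scope.

Definition sumset (T : finZmodType) (A B : {set T}) : {set T} :=
  [set a + b | a in A, b in B].

Definition additive_energy (T : finZmodType) (A : {set T}) : nat :=
  #|[set q : T * T * T * T |
      let: (x, y, z, w) := q in
      [&& x \in A, y \in A, z \in A, w \in A & x + y == z + w]]|.

(* A subgroup of the unit group, viewed as a subset of the field itself so that
   its elements can be added. *)
Definition subgroup_set (F : finFieldType) (A : {group {unit F}}) : {set F} :=
  [set val u | u in A].

(* Main.v *)
Require Import Defs.
From HB Require Import structures.
From mathcomp Require Import all_boot all_order all_algebra all_fingroup.
From mathcomp Require Import reals exp.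
From mathcomp Require Import cyclic.
From mathcomp Require Import zify ring lra.
Set Implicit Arguments.
Unset Strict Implicit.
Unset Printing Implicit Defensive.
Import Order.TTheory GRing.Theory Num.Theory.
Local Open Scope ring_scope.

(* Put t = |A|. The A-coset of x <> 0 is determined by x^t. Stepanov's method
   shows that, for k << min(t^2, p^3 / t^4), at most O((k t)^(2/3)) points x have
   (x^t, (1-x)^t) in a given set of k pairs. The number r(d) of representations
   of d <> 0 as a difference of elements of A is the number of points over one
   pair, so the level sets of r are small: E(A) << t^(5/2) and
   sum_d r(d)^3 << t^3 log t.

   Now E(A) is the sum of r(x - z) over x, z in A; put rho = (z+1)/(x+1).
   If few points (at most about 1 + t^2/p) lie over the pair of rho,
   Cauchy-Schwarz over the pairs of sums (x+y, z+y), y in A, gives the second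
   term of the maximum. Otherwise apply Cauchy-Schwarz over the values of rho
   alone: the number of (x, z) with a given rho is again the number of points
   over a pair, hence sum_rho n(rho)^2 << t^2 log t, and the rho coming from
   differences with r(x - z) >= u lie over at most |2A|^2 |{r >= u}| / t^3 pairs.
   Keying on rho alone, rather than on rho and the coset of x + 1, is what avoids
   counting a pair with multiplicity and makes Stepanov's bound applicable. *)

(** * Stepanov's method *)
Section StepanovPoly.
Variable F : fieldType.

(** The factor X(1-X) lets the derivation preserve the exponents n and m in products q X^n (1-X)^m.
    Away from the points 0 and 1 it does not vanish, so iterates still detect orders of vanishing up
    to p. *)
Definition theta (P : {poly F}) : {poly F} := 'X * (1 - 'X) * P^`().

Lemma thetaZD (a : F) (P Q : {poly F}) : theta (a *: P + Q) = a *: theta P + theta Q.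
Proof. by rewrite /theta derivD derivZ mulrDr scalerAr. Qed.

Lemma iter_thetaZD d (a : F) (P Q : {poly F}) :
  iter d theta (a *: P + Q) = a *: iter d theta P + iter d theta Q.
Proof. by elim: d => //= d ->; rewrite thetaZD. Qed.

Lemma iter_theta_sum d (I : finType) (a : I -> F) (P : I -> {poly F}) :
  iter d theta (\sum_i a i *: P i) = \sum_i a i *: iter d theta (P i).
Proof.
elim/big_rec2: _ => [|i Q1 Q2 _ <-]; last exact: iter_thetaZD.
by elim: d => //= d ->; rewrite /theta derivC mulr0.
Qed.

Definition twist (n m : nat) (q : {poly F}) : {poly F} :=
  'X * (1 - 'X) * q^`() + (n%:R *: (1 - 'X) - m%:R *: 'X) * q.

Lemma theta_twist n m q :
  theta (q * ('X^n * (1 - 'X) ^+ m)) = twist n m q * ('X^n * (1 - 'X) ^+ m).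
Proof.
have dX : 'X * ('X^n)^`() = n%:R * 'X^n :> {poly F}.
  case: n => [|n]; first by rewrite derivC mulr0 mul0r.
  by rewrite derivXn /= -mulr_natl mulrCA -exprS.
have d1X : (1 - 'X) * ((1 - 'X) ^+ m)^`() = - m%:R * (1 - 'X) ^+ m :> {poly F}.
  case: m => [|m]; first by rewrite derivC mulr0 oppr0 mul0r.
  by rewrite deriv_exp derivB derivX derivC /= -mulr_natl sub0r mulN1r !mulrN mulrCA -exprS mulNr.
rewrite /theta /twist -!mul_polyC !polyC_natr derivM [('X^n * _)^`()]derivM.
move: dX d1X; set u := 'X^n; set v := (1 - 'X) ^+ m; set u' := u^`(); set v' := v^`().
move: u v u' v' (n%:R) (m%:R) q^`() => u v u' v' a b q' dX d1X.
transitivity ('X * (1 - 'X) * q' * (u * v) + q * (('X * u') * (1 - 'X) * v + 'X * u * ((1 - 'X) * v'))).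
  by ring.
by rewrite dX d1X; ring.
Qed.

Lemma iter_theta_twist d n m q :
  iter d theta (q * ('X^n * (1 - 'X) ^+ m)) =
  iter d (twist n m) q * ('X^n * (1 - 'X) ^+ m).
Proof. by elim: d => //= d ->; rewrite theta_twist. Qed.

(** The size grows by at most one per application, whatever n and m are. This keeps the number of
    linear conditions independent of the large exponents. *)
Lemma size_twist n m q : (size (twist n m q) <= (size q).+1)%N.
Proof.
have s1X : (size ((1 - 'X)%R : {poly F}) <= 2)%N.
  by rewrite -opprB size_polyN -polyC1 size_XsubC.
apply: (leq_trans (size_polyD _ _)); rewrite geq_max; apply/andP; split.
  have [->|q0] := eqVneq q^`() 0; first by rewrite mulr0 size_poly0.
  have sq : (size q^`() < size q)%N.
    by apply: lt_size_deriv; apply: contraNneq q0 => ->; rewrite linear0.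
  have [->|q1] := eqVneq q 0; first by rewrite linear0 mulr0 size_poly0.
  have sM : (size ('X * (1 - 'X) : {poly F})%R <= 3)%N.
    apply: (leq_trans (size_polyMleq _ _)); rewrite size_polyX.
    by rewrite (@leq_trans (2 + 2).-1)// -!subn1 leq_sub2r// leq_add2l.
  apply: (leq_trans (size_polyMleq _ _)).
  by move: sM sq; set a := size _; set b := size _; set d := size _; lia.
have sM : (size (n%:R *: (1 - 'X) - m%:R *: 'X : {poly F})%R <= 2)%N.
  apply: (leq_trans (size_polyD _ _)); rewrite size_polyN geq_max; apply/andP; split.
    by apply: (leq_trans (size_scale_leq _ _)); exact: s1X.
  by apply: (leq_trans (size_scale_leq _ _)); rewrite size_polyX.
apply: (leq_trans (size_polyMleq _ _)).
by move: sM; set a := size _; set b := size _; lia.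
Qed.

Lemma size_iter_twist d n m q : (size (iter d (twist n m) q) <= size q + d)%N.
Proof.
elim: d => [|d IH] /=; first by rewrite addn0.
by rewrite addnS (leq_trans (size_twist _ _ _)).
Qed.

(** Unknowns are indexed by I and equations by J: the matrix has more rows than columns, so its left
    kernel is nonzero. *)
Lemma underdetermined (I J : finType) (M : I -> J -> F) : (#|J| < #|I|)%N ->
  exists a : I -> F, (exists i, a i != 0) /\ forall j, \sum_i a i * M i j = 0.
Proof.
move=> JI.
pose A := \matrix_(i < #|I|, j < #|J|) M (enum_val i) (enum_val j).
have : kermx A != 0.
  rewrite -mxrank_eq0 mxrank_ker -lt0n subn_gt0.
  exact: leq_ltn_trans (rank_leq_col _) JI.
case/rowV0Pn => v /sub_kermxP vA v0.
exists (fun i => v 0 (enum_rank i)); split.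
  have /rV0Pn[i vi] := v0; by exists (enum_val i); rewrite enum_valK.
move=> j; have /rowP/(_ (enum_rank j)) := vA; rewrite !mxE => vAj; rewrite -[RHS]vAj.
rewrite [LHS](reindex (fun i : 'I_#|I| => enum_val i)) /=; last first.
  by exists enum_rank => x _; rewrite ?enum_rankK ?enum_valK.
by apply/eq_bigr => i _; rewrite !mxE enum_valK enum_rankK.
Qed.

Lemma dvdp_prod_XsubC_exp (s : seq F) (D : nat) (P : {poly F}) : uniq s ->
  (forall x, x \in s -> ('X - x%:P) ^+ D %| P) ->
  \prod_(x <- s) ('X - x%:P) ^+ D %| P.
Proof.
elim: s => [|x s IH] /=; first by rewrite big_nil dvd1p.
move=> /andP[xs us] H; rewrite big_cons Gauss_dvdp.
  rewrite H ?mem_head// IH// => y ys; by apply: H; rewrite inE ys orbT.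
by rewrite coprimep_expl// prodrXl coprimep_expr// coprimep_sym coprimep_XsubC root_prod_XsubC.
Qed.

Lemma size_mult_roots (s : seq F) (D : nat) (P : {poly F}) : P != 0 -> uniq s ->
  (forall x, x \in s -> ('X - x%:P) ^+ D %| P) -> (size s * D < size P)%N.
Proof.
move=> P0 us H; have := dvdp_leq P0 (dvdp_prod_XsubC_exp us H).
have Q0 : \prod_(x <- s) ('X - x%:P) != 0 by exact: monic_neq0 (monic_prod_XsubC _ _ _).
rewrite prodrXl; apply: leq_trans; rewrite -[X in (_ < X)%N]prednK.
  by rewrite size_exp size_prod_XsubC.
by rewrite size_poly_gt0 expf_neq0.
Qed.
End StepanovPoly.

(** * Sparse polynomials and orders of vanishing in characteristic p *)

Section SmallDegree.
Variables (F : fieldType) (p : nat).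
Hypothesis charF : p \in [pchar F].

Lemma natf_neq0_small (n : nat) : (0 < n < p)%N -> n%:R != 0 :> F.
Proof.
move=> /andP[n0 np]; rewrite -(dvdn_pcharf charF).
by apply/negP => /(dvdn_leq n0); rewrite leqNgt np.
Qed.

Lemma natf_inj_small (i j : nat) :
  (i < p)%N -> (j < p)%N -> i%:R = j%:R :> F -> i = j.
Proof.
wlog ij : i j / (i <= j)%N.
  move=> H ip jp e; case: (leqP i j) => h; first exact: H.
  by apply/esym/H => //; exact: ltnW.
move=> ip jp e; apply/eqP; move: ij; rewrite leq_eqVlt => /orP[//|ij].
have : (j - i)%:R != 0 :> F.
  by apply: natf_neq0_small; rewrite subn_gt0 ij (leq_ltn_trans (leq_subr _ _)).
by rewrite natrB ?(ltnW ij)// e subrr eqxx.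
Qed.

(** Induction on the number of terms. For the first exponent m, passing from g to X g' - m g kills
    X^m, multiplies each other coefficient by i - m, which is nonzero because the exponents are
    distinct and below p, and costs one factor 1 - X. *)
Lemma sparse_eq0 (e : seq nat) (c : nat -> F) (s : nat) :
  uniq e -> all (fun i => i < p)%N e -> (size e <= s)%N ->
  (1 - 'X) ^+ s %| \sum_(i <- e) c i *: 'X^i ->
  {in e, forall i, c i = 0}.
Proof.
elim: e c s => [//|m e IH] c [//|s] /= /andP[me ue] /andP[mp ep] les.
rewrite big_cons => /dvdpP[h defg].
set g := _ + _ in defg.
have E : 'X * g^`() - m%:R *: g = \sum_(i <- e) (c i * (i%:R - m%:R)) *: 'X^i.
  rewrite /g derivD linearZ/= derivXn [deriv _]raddf_sum/=.
  rewrite mulrDr scalerDr opprD addrACA.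
  have -> : 'X * (c m *: ('X^(m.-1) *+ m)) - m%:R *: (c m *: 'X^m) = 0.
    case: m {me mp defg g} => [|m] /=; first by rewrite mulr0n scaler0 mulr0 scale0r subr0.
    by rewrite -!mul_polyC polyC_natr -mulr_natr exprS; ring.
  rewrite add0r mulr_sumr scaler_sumr -sumrB; apply: eq_bigr => i _.
  rewrite derivZ derivXn -scalerAr mulrnAr; case: i => [|i] /=.
    by rewrite mulr0n scaler0 !sub0r scalerA mulrN mulrC scaleNr.
  by rewrite -exprS -scaler_nat !scalerA -scalerBl mulrBr (mulrC m%:R).
have D : (1 - 'X) ^+ s %| \sum_(i <- e) (c i * (i%:R - m%:R)) *: 'X^i.
  rewrite -E; apply/dvdpP.
  exists ('X * ((1 - 'X) * h^`() - s.+1%:R *: h) - m%:R *: (1 - 'X) * h).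
  rewrite defg derivM deriv_exp derivB derivX derivC /= exprS.
  rewrite -!mul_polyC polyC_natr -mulr_natr; ring.
have c0 : {in e, forall i, c i = 0}.
  move=> i ie; have := IH _ _ ue ep les D i ie => /eqP.
  rewrite mulf_eq0 subr_eq0 => /orP[/eqP//|/eqP eq].
  move: me; rewrite -(natf_inj_small _ _ eq) ?ie//.
  by have /allP/(_ _ ie) := ep.
move=> i; rewrite inE => /orP[/eqP->|/c0//].
(* Only the term of exponent m is left; evaluation at 1 reads off its coefficient. *)
have : g.[1] = 0 by rewrite defg hornerM horner_exp !hornerE subrr expr0n mulr0.
rewrite /g big1_seq ?addr0; last by move=> j /andP[_ /c0->]; rewrite scale0r.
by rewrite !hornerE expr1n mulr1.
Qed.

(** Modulo (1-X)^t only the summand j = 0 survives, and [sparse_eq0] kills it. Then (1-X)^t is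
    cancelled and the induction continues. *)
Lemma sparse_sum_eq0 (e : seq nat) (t m : nat) (c : nat -> nat -> F) :
  uniq e -> all (fun i => i < p)%N e -> (size e <= t)%N ->
  \sum_(j < m) (\sum_(i <- e) c j i *: 'X^i) * (1 - 'X) ^+ (t * j) = 0 ->
  forall j, (j < m)%N -> {in e, forall i, c j i = 0}.
Proof.
move=> ue ep et; elim: m c => [//|m IH] c.
rewrite big_ord_recl muln0 expr0 mulr1.
have -> : \sum_(j < m) (\sum_(i <- e) c (lift ord0 j) i *: 'X^i) * (1 - 'X) ^+ (t * lift ord0 j)
  = (\sum_(j < m) (\sum_(i <- e) c j.+1 i *: 'X^i) * (1 - 'X) ^+ (t * j)) * (1 - 'X) ^+ t.
  by rewrite mulr_suml; apply: eq_bigr => j _; rewrite lift0 mulnS addnC exprD mulrA.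
move=> E.
have c0 : {in e, forall i, c 0 i = 0}.
  apply: (sparse_eq0 ue ep et); apply/dvdpP.
  exists (- \sum_(j < m) (\sum_(i <- e) c j.+1 i *: 'X^i) * (1 - 'X) ^+ (t * j)).
  by rewrite mulNr; apply/eqP; rewrite -addr_eq0 E.
move: E; rewrite big1_seq ?add0r => [/eqP|i /andP[_ /c0->]]; last by rewrite scale0r.
rewrite mulf_eq0 expf_eq0 => /orP[/eqP E|/andP[_ /eqP /(congr1 (fun q => q.[0]))]].
  by case=> [//|j] jm; exact: (IH (fun j => c j.+1) E).
by move/eqP; rewrite hornerD hornerN hornerX hornerC horner0 subr0 oner_eq0.
Qed.

(** By induction applied to [theta P], and since X(1-X) is coprime to X - x, the derivative P' is
    divisible by (X-x)^D. A positive multiplicity of x in P that is at most D, hence below p, would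
    drop by exactly one in P', a contradiction. *)
Lemma dvdp_of_theta (x : F) (D : nat) (P : {poly F}) :
  x != 0 -> x != 1 -> (D <= p)%N ->
  (forall d, (d < D)%N -> (iter d (@theta F) P).[x] = 0) -> ('X - x%:P) ^+ D %| P.
Proof.
move=> x0 x1; elim: D P => [|D IH] P Dp H; first by rewrite expr0 dvd1p.
have [->|P0] := eqVneq P 0; first exact: dvdp0.
have : ('X - x%:P) ^+ D %| theta P.
  apply: IH; first exact: ltnW.
  by move=> d dD; rewrite -iterSr; exact: H.
rewrite /theta Gauss_dvdpr; last first.
  rewrite coprimep_expl// coprimep_sym coprimep_XsubC rootM negb_or /root hornerX x0.
  by rewrite hornerD hornerN hornerX hornerC subr_eq0 eq_sym x1.
have [m [V]] := multiplicity_XsubC P x; rewrite P0 /= => rV E dP.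
case: (ltnP D m) => [Dm|mD]; first by rewrite E dvdp_mull// dvdp_exp2l.
have := H 0%N isT; rewrite /= E; case: m => [|m] in mD E *.
  by rewrite expr0 mulr1 => /eqP V0; rewrite /root V0 in rV.
move=> _; exfalso.
have : ('X - x%:P) ^+ m.+1 %| P^`() by apply: dvdp_trans dP; exact: dvdp_exp2l.
have -> : P^`() = (V^`() * ('X - x%:P) + m.+1%:R * V) * ('X - x%:P) ^+ m.
  by rewrite E derivM deriv_exp derivXsubC /= -mulr_natr exprS; ring.
rewrite exprS dvdp_mul2r ?expf_neq0 ?polyXsubC_eq0// dvdp_XsubCl.
rewrite /root !hornerE subrr mulr0 add0r -polyC_natr hornerC mulf_eq0.
rewrite (negPf (natf_neq0_small _)) /=; last by rewrite (leq_ltn_trans mD).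
by move: rV; rewrite /root => /negPf->.
Qed.

End SmallDegree.

(** * Stepanov's bound for the points over a set of pairs *)

Section StepanovBound.
Variables (F : finFieldType) (p t : nat).
Hypothesis charF : p \in [pchar F].
Hypothesis t0 : (0 < t)%N.

(* For x <> 0, 1, the cosets of x and 1 - x modulo the t-th roots of unity. *)
Definition kappa (x : F) : F * F := (x ^+ t, (1 - x) ^+ t).

Definition points_over (K : {set F * F}) : {set F} := [set x | kappa x \in K].

(** Excludes the points 0 and 1, where [theta] always produces a zero and its iterates say nothing
    about multiplicity. *)
Definition zero_free (K : {set F * F}) := forall k, k \in K -> (k.1 != 0) && (k.2 != 0).

(** Here n is the order of vanishing and B bounds the exponents of x^t and (1-x)^t. The n B^2
    unknown coefficients outnumber the 2 n^2 |K| linear conditions; n B <= t and t B <= p make the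
    monomials independent, so the polynomial is nonzero, and its degree bounds the number of roots
    counted n times. *)
Lemma stepanov_core (K : {set F * F}) (n B : nat) :
  zero_free K -> (0 < n)%N -> (n * B <= t)%N -> (t * B <= p)%N ->
  (2 * #|K| * n < B ^ 2)%N -> (#|points_over K| * n < n + 2 * t * B)%N.
Proof.
move=> K0 n0 nBt tBp kB.
have B0 : (0 < B)%N by move: kB; case: B {nBt tBp}.
have nt : (n <= t)%N by apply: leq_trans nBt; rewrite leq_pmulr.
have np : (n <= p)%N by apply: (leq_trans nt); apply: leq_trans tBp; rewrite leq_pmulr.
pose I := ('I_n * 'I_B * 'I_B)%type.
(* For a, d < n, applying [twist] d times to X^a gives size at most 2n: hence 2n coefficients for
   each pair and each d. *)
pose J := ({k | k \in K} * 'I_n * 'I_(2 * n))%type.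
pose M (i : I) (j : J) := (iter j.1.2 (twist (t * i.1.2) (t * i.2)) 'X^(i.1.1))`_j.2
  * ((val j.1.1).1 ^+ i.1.2 * (val j.1.1).2 ^+ i.2).
have JI : (#|{: J}| < #|{: I}|)%N.
  rewrite !card_prod card_sig !card_ord.
  have -> : #|[pred x | x \in K]| = #|K| by apply: eq_card.
  move: kB n0; clear; nia.
have [l [[i0 li0] lM]] := underdetermined M JI.
(* Psi is a polynomial in x, x^t, (1-x)^t; on a point over a pair of K the last
   two are constant, so vanishing to order n there is a linear condition. *)
pose mono (i : I) : {poly F} := 'X^(i.1.1) * ('X^(t * i.1.2) * (1 - 'X) ^+ (t * i.2)).
pose Psi := \sum_i l i *: mono i.
have sPsi : (size Psi <= n + 2 * t * B)%N.
  apply: (leq_trans (size_sum _ _ _)); apply/bigmax_leqP => -[[a b] c] _.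
  apply: (leq_trans (size_scale_leq _ _)); rewrite /mono /= mulrA -exprD.
  apply: (leq_trans (size_polyMleq _ _)); rewrite size_polyXn.
  have s1X : (size ((1 - 'X)%R : {poly F}) = 2)%N.
    by rewrite -opprB size_polyN -polyC1 size_XsubC.
  have := size_poly_exp_leq (1 - 'X : {poly F}) (t * c); rewrite s1X /=.
  have := ltn_ord a; have := ltn_ord b; have := ltn_ord c.
  set s := size _; clear; nia.
have Psi0 : Psi != 0.
  apply/eqP => Psi0; move/eqP: li0; apply.
  (* The exponent of X in a monomial. It determines (a, b) since a < n <= t, and it is below t B <=
     p, as sparsity in characteristic p requires. *)
  pose code (ab : 'I_n * 'I_B) : nat := (ab.1 + t * ab.2)%N.
  have code_inj : injective code.
    move=> [a b] [a' b'] /= E.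
    have codeD (i : 'I_n) (j : 'I_B) : (code (i, j) %/ t = j)%N.
      by rewrite /code /= addnC mulnC divnMDl// divn_small ?addn0// (leq_trans (ltn_ord i)).
    have bb : b = b' :> nat by rewrite -(codeD a b) E codeD.
    move: E; rewrite /code /= bb => /addIn aa.
    by congr pair; apply: val_inj.
  pose e := [seq code ab | ab <- enum {: 'I_n * 'I_B}].
  pose c j i := if insub j is Some j' then \sum_(ab | code ab == i) l (ab, j') else 0.
  have cE (ab : 'I_n * 'I_B) (j : 'I_B) : c j (code ab) = l (ab, j).
    rewrite /c valK (big_pred1 ab)// => ab'.
    by rewrite (inj_eq code_inj).
  case: i0 => ab j; rewrite -cE.
  apply: (@sparse_sum_eq0 _ _ charF e t B) => //.
  - by rewrite map_inj_uniq// enum_uniq.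
  - apply/allP => _ /mapP[[a b] _ ->]; rewrite /code /=.
    have := ltn_ord a; have := ltn_ord b; move: nt tBp n0; clear; nia.
  - by rewrite size_map -cardE card_prod !card_ord.
  - have PsiE : Psi = \sum_ab \sum_j l (ab, j) *: mono (ab, j).
      by rewrite pair_bigA; apply: eq_bigr => -[].
    rewrite -[RHS]Psi0 PsiE exchange_big /=; apply: eq_bigr => j' _.
    rewrite big_map big_enum mulr_suml; apply: eq_bigr => -[a b] _.
    by rewrite cE /mono /code /= exprD -!scalerAl mulrA.
  - by apply: map_f; rewrite mem_enum.
have roots x : x \in enum (points_over K) -> ('X - x%:P) ^+ n %| Psi.
  rewrite mem_enum inE => xK; have /andP[/= x0 x1] := K0 _ xK.
  apply: (dvdp_of_theta charF) => //.
  - by apply: contraNneq x0 => ->; rewrite expf_eq0 t0 eqxx.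
  - by apply: contraNneq x1 => ->; rewrite subrr expf_eq0 t0 eqxx.
  move=> d dn; rewrite /Psi iter_theta_sum horner_sum.
  pose jj j : J := (exist (fun k => k \in K) _ xK, Ordinal dn, j).
  transitivity (\sum_(j < 2 * n) x ^+ j * \sum_i l i * M i (jj j)); last first.
    by apply: big1 => j _; rewrite lM mulr0.
  under [RHS]eq_bigr => j _ do rewrite mulr_sumr.
  rewrite exchange_big /=; apply: eq_bigr => -[[a b] c] _.
  rewrite hornerZ /mono iter_theta_twist /= hornerM.
  rewrite (@horner_coef_wide _ (2 * n)%N); last first.
    have := size_iter_twist d (t * b) (t * c) ('X^a : {poly F}); rewrite size_polyXn.
    have := ltn_ord a; have := dn; set s := size _; clear; lia.
  rewrite mulr_suml mulr_sumr; apply: eq_bigr => j _.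
  rewrite /M /= hornerM horner_exp hornerX horner_exp hornerD hornerN hornerX hornerC.
  by rewrite !exprM; ring.
have := size_mult_roots Psi0 (enum_uniq _) roots.
by rewrite -cardE => h; exact: leq_trans h sPsi.
Qed.

(** B is the least integer with B^3 > 2 |K| t, and n is the integer part of t / B. Minimality gives
    B^3 <= 16 |K| t, and the two size hypotheses turn this into B <= t and t B <= p. The constant is
    5^3 times 16^2. *)
Lemma stepanov (K : {set F * F}) :
  zero_free K -> (16 * #|K| <= t ^ 2)%N -> (16 * #|K| * t ^ 4 <= p ^ 3)%N ->
  (#|points_over K| ^ 3 <= 125 * 256 * (#|K| * t) ^ 2)%N.
Proof.
move=> K0 kt kp; case: (posnP #|K|) => [k0|k0].
  have -> : points_over K = set0; last by rewrite cards0.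
  by apply/setP => x; rewrite !inE (cards0_eq k0) inE.
have ex : exists B, (2 * (#|K| * t) < B ^ 3)%N.
  exists (2 * (#|K| * t)).+1; move: (2 * _)%N => m; nia.
case: (ex_minnP ex) => B kB Bmin.
have B2 : (2 <= B)%N by move: kB; case: B {Bmin} => [|[|//]]; nia.
have : (B.-1 ^ 3 <= 2 * (#|K| * t))%N.
  by rewrite leqNgt; apply/negP => /Bmin; move: B2; clear; lia.
move=> Bk.
have B16 : (B ^ 3 <= 16 * (#|K| * t))%N.
  have : (B ^ 3 <= (2 * B.-1) ^ 3)%N by rewrite leq_exp2r//; move: B2; clear; lia.
  by rewrite expnMn; move: Bk; clear; lia.
have Bt : (B <= t)%N.
  rewrite -(@leq_exp2r _ _ 3)//; apply: (leq_trans B16).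
  by rewrite mulnA [X in (_ <= X)%N]expnSr leq_mul2r kt orbT.
have tBp : (t * B <= p)%N.
  rewrite -(@leq_exp2r _ _ 3)// expnMn.
  apply: leq_trans kp; apply: (@leq_trans (t ^ 3 * (16 * (#|K| * t)))).
    by rewrite leq_mul2l B16 orbT.
  by rewrite (expnSr t 3); clear; lia.
pose n := (t %/ B)%N.
have Bgt0 : (0 < B)%N by apply: leq_trans B2.
have n0 : (0 < n)%N by rewrite divn_gt0.
have nBt : (n * B <= t)%N by exact: leq_trunc_div.
have tn : (t < n.+1 * B)%N by rewrite ltn_ceil.
have kn : (2 * #|K| * n < B ^ 2)%N.
  rewrite -(ltn_pmul2r Bgt0) -expnSr; apply: leq_ltn_trans kB.
  by rewrite mulnA -(mulnA _ n B) leq_mul2l nBt orbT.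
have H := stepanov_core K0 n0 nBt tBp kn.
(* Since t < (n + 1) B <= 2 n B, the bound N n < n + 2 t B yields N < 1 + 4 B^2. *)
have N5 : (#|points_over K| <= 5 * B ^ 2)%N.
  move: H tn n0 B2; set N := #|points_over K|; clear; nia.
have : (#|points_over K| ^ 3 <= (5 * B ^ 2) ^ 3)%N by rewrite leq_exp2r.
move=> h; apply: (leq_trans h).
have -> : ((5 * B ^ 2) ^ 3 = 125 * (B ^ 3) ^ 2)%N by rewrite expnMn -!expnM.
have : ((B ^ 3) ^ 2 <= 256 * (#|K| * t) ^ 2)%N.
  by rewrite -[256%N]/(16 ^ 2)%N -expnMn leq_exp2r.
by set u := ((B ^ 3) ^ 2)%N; set v := ((#|K| * t) ^ 2)%N; clear; lia.
Qed.

End StepanovBound.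

(** * Sums over level sets *)

(** Both sides are doubled and expanded as double sums, then compared termwise by 2 x y <= x^2 + y^2
    with x = a_i b_j and y = a_j b_i. *)
Lemma nat_cauchy_schwarz (I : finType) (P : pred I) (a b : I -> nat) :
  ((\sum_(i | P i) a i * b i) ^ 2 <= (\sum_(i | P i) a i ^ 2) * \sum_(i | P i) b i ^ 2)%N.
Proof.
set PQ := (X in (_ <= X)%N).
have E1 : PQ = (\sum_(i | P i) \sum_(j | P j) a i ^ 2 * b j ^ 2)%N by rewrite /PQ big_distrlr.
have E2 : PQ = (\sum_(i | P i) \sum_(j | P j) a j ^ 2 * b i ^ 2)%N by rewrite E1 exchange_big.
suff : (2 * (\sum_(i | P i) a i * b i) ^ 2 <= PQ + PQ)%N by lia.
rewrite [X in (X + _)%N]E1 E2 -big_split -mulnn big_distrlr big_distrr /=.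
apply: leq_sum => i _; rewrite -big_split big_distrr /=; apply: leq_sum => j _.
have [+ _] := nat_Cauchy (a i * b j) (a j * b i); rewrite !expnMn.
suff -> : (a i * b i * (a j * b j) = a i * b j * (a j * b i))%N by [].
by rewrite mulnACA (mulnC (b i)) mulnACA.
Qed.

Section Levels.
Variables (R : realFieldType) (I : finType) (G : {set I}) (f : I -> nat) (t : nat) (W : R).
Hypothesis f_le : forall i, i \in G -> (f i <= t)%N.
Hypothesis levels : forall v, (0 < v)%N ->
  v%:R ^+ 3 * #|[set i in G | (v <= f i)%N]|%:R <= W.

Let card_level v : #|[set i in G | (v < f i)%N]|%:R <= W / v.+1%:R ^+ 3.
Proof. by rewrite ler_pdivlMr ?exprn_gt0// mulrC; exact: levels. Qed.

Let sum_level v (c : R) :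
  \sum_(i in G | (v < f i)%N) c = c * #|[set i in G | (v < f i)%N]|%:R.
Proof.
by rewrite sumr_const mulr_natr; congr (_ *+ _); apply: eq_card => i; rewrite !inE.
Qed.

(** Layer by layer, n^3 is at most the sum of 3 (v+1)^2 over v < n. After exchanging the sums, the
    level bound W / (v+1)^3 leaves a harmonic sum. *)
Lemma sum_cube_levels :
  \sum_(i in G) (f i)%:R ^+ 3 <= 3 * W * \sum_(v < t) v.+1%:R^-1.
Proof.
have cube i : i \in G -> (f i)%:R ^+ 3 <= \sum_(v < t | (v < f i)%N) 3 * v.+1%:R ^+ 2 :> R.
  move=> /f_le fit; rewrite (big_ord_narrow fit) /=.
  elim: (f i) => [|n IH]; first by rewrite big_ord0 expr0n.
  rewrite big_ord_recr /=; apply: le_trans (lerD IH (lexx _)).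
  by rewrite -natr1; have := ler0n R n; nra.
apply: (le_trans (ler_sum _ cube)).
rewrite (exchange_big_dep xpredT) //= mulr_sumr; apply: ler_sum => v _.
rewrite sum_level -mulrA -!mulrA ler_pM2l//.
have v0 : 0 < v.+1%:R :> R by [].
have := card_level v; rewrite ler_pdivlMr ?exprn_gt0// => h.
by rewrite ler_pdivlMr//; move: h; set c := #|_|%:R; set w := v.+1%:R; lra.
Qed.

(** Each square is cut into T^2 and layers 2 (v+1) with v >= T. The first part contributes W / T;
    the second leaves a sum of 2 W / (v+1)^2, which telescopes against 2 W / v to at most 2 W /
    T. *)
Lemma sum_sqr_levels (T : nat) : (0 < T)%N ->
  \sum_(i in G | (T <= f i)%N) (f i)%:R ^+ 2 <= 3 * W / T%:R.
Proof.
move=> T0; have T0' : 0 < T%:R :> R by rewrite ltr0n.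
have sqr i : (i \in G) && (T <= f i)%N -> (f i)%:R ^+ 2 <=
    T%:R ^+ 2 + \sum_(T <= v < t | (v < f i)%N) 2 * v.+1%:R :> R.
  move=> /andP[/f_le fit Tf].
  have -> : \sum_(T <= v < t | (v < f i)%N) 2 * v.+1%:R = \sum_(T <= v < f i) 2 * v.+1%:R :> R.
    rewrite (big_cat_nat Tf fit) /= [X in _ + X]big1_seq ?addr0; last first.
      by move=> v /andP[vf]; rewrite mem_index_iota leqNgt vf.
    by rewrite big_nat_cond [RHS]big_nat_cond; apply: eq_bigl => v; case: (v < f i)%N; rewrite ?andbF ?andbT.
  elim: (f i) Tf {fit} => [|n IH]; first by rewrite leqn0 => /eqP->; rewrite big_geq// addr0.
  rewrite leq_eqVlt => /orP[/eqP->|]; first by rewrite big_geq// addr0.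
  rewrite ltnS => Tn; rewrite big_nat_recr//= addrA.
  apply: le_trans (lerD (IH Tn) (lexx _)).
  by rewrite -natr1; have := ler0n R n; nra.
apply: (le_trans (ler_sum _ sqr)).
have cT : #|[set i in G | (T <= f i)%N]|%:R <= W / T%:R ^+ 3.
  by rewrite ler_pdivlMr ?exprn_gt0// mulrC; exact: levels.
have W0 : 0 <= W by apply: le_trans (levels T0); rewrite mulr_ge0// exprn_ge0.
rewrite big_split /= (_ : 3 * W / T%:R = W / T%:R + 2 * W / T%:R); last by field; exact: lt0r_neq0.
apply: lerD.
  have -> : \sum_(i in G | (T <= f i)%N) T%:R ^+ 2 =
      T%:R ^+ 2 * #|[set i in G | (T <= f i)%N]|%:R :> R.
    by rewrite sumr_const mulr_natr; congr (_ *+ _); apply: eq_card => i; rewrite !inE.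
  apply: (le_trans (ler_wpM2l _ cT)); first exact: exprn_ge0.
  by rewrite le_eqVlt; apply/orP; left; apply/eqP; field; exact: lt0r_neq0.
rewrite (exchange_big_dep xpredT) //=.
have tele n : (T <= n)%N -> \sum_(T <= v < n) 2 * W / v.+1%:R ^+ 2 <= 2 * W / T%:R - 2 * W / n%:R.
  elim: n => [|n IH]; first by rewrite leqn0 => /eqP E; rewrite E in T0.
  rewrite leq_eqVlt => /orP[/eqP->|]; first by rewrite big_geq// subrr.
  rewrite ltnS => Tn; rewrite big_nat_recr//=; apply: (le_trans (lerD (IH Tn) (lexx _))).
  have n0 : 0 < n%:R :> R by rewrite ltr0n (leq_trans T0).
  have n1 : 0 < n.+1%:R :> R by [].
  suff : 2 * W / n.+1%:R ^+ 2 <= 2 * W / n%:R - 2 * W / n.+1%:R.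
    by move=> h; rewrite -addrA lerD2l addrC lerBlDr addrC.
  have -> : 2 * W / n%:R - 2 * W / n.+1%:R = 2 * W / (n%:R * n.+1%:R).
    by move: n1; rewrite -natr1 => n1; field; rewrite !lt0r_neq0.
  rewrite ler_wpM2l ?mulr_ge0// lef_pV2 ?posrE ?mulr_gt0 ?exprn_gt0//.
  by rewrite expr2 ler_pM2r// ler_nat.
have : \sum_(T <= v < t) 2 * W / v.+1%:R ^+ 2 <= 2 * W / T%:R.
  case: (leqP T t) => [Tt|tT]; last by rewrite big_geq ?(ltnW tT)// divr_ge0 ?mulr_ge0// ltW.
  by apply: (le_trans (tele _ Tt)); rewrite gerBl divr_ge0// mulr_ge0.
apply: le_trans; apply: ler_sum => v _.
have -> : \sum_(i | (i \in G) && (T <= f i)%N && (v < f i)%N) 2 * v.+1%:R =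
   2 * v.+1%:R * #|[set i in G | (T <= f i)%N & (v < f i)%N]|%:R :> R.
  by rewrite sumr_const [RHS]mulr_natr; congr (_ *+ _); apply: eq_card => i; rewrite !inE andbA.
have v0 : 0 < v.+1%:R :> R by [].
have : #|[set i in G | (T <= f i)%N & (v < f i)%N]|%:R <= W / v.+1%:R ^+ 3.
  apply: le_trans (card_level v); rewrite ler_nat subset_leq_card//.
  by apply/subsetP => i; rewrite !inE => /and3P[-> _ ->].
move=> h; apply: (le_trans (ler_wpM2l _ h)); first by rewrite mulr_ge0// ltW.
by rewrite le_eqVlt; apply/orP; left; apply/eqP; field; rewrite addrC natr1 lt0r_neq0.
Qed.
End Levels.

(** * Representations by differences *)

Section LevelSets.
Variables (F : finFieldType) (t : nat) (A : {set F}).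
Hypothesis t0 : (0 < t)%N.
Hypothesis memA : forall x, (x \in A) = (x ^+ t == 1).
Hypothesis cardA : #|A| = t.

Definition fiber (k : F * F) : nat := #|[set y | kappa t y == k]|.
Definition reps (d : F) : nat := #|[set x in A | x - d \in A]|.

Lemma memA_neq0 x : x \in A -> x != 0.
Proof. by rewrite memA; apply: contraTneq => ->; rewrite expr0n gtn_eqF// eq_sym oner_eq0. Qed.

Lemma card_roots_le (a : F) : (#|[set x : F | x ^+ t == a]| <= t)%N.
Proof.
have := size_XnsubC a t0 => sz; rewrite cardE -ltnS -sz.
apply: max_poly_roots; last exact: enum_uniq.
  by rewrite -size_poly_eq0 sz.
by apply/allP => x; rewrite mem_enum inE /root !hornerE => /eqP->; rewrite subrr.
Qed.

Lemma card_roots_eq (y : F) : y != 0 -> #|[set x | x ^+ t == y ^+ t]| = t.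
Proof.
move=> y0; rewrite -[RHS]cardA -[RHS](card_imset _ (mulIf y0)); apply: eq_card => x.
rewrite inE; apply/idP/imsetP => [xy|[a aA ->]]; last first.
  by move: aA; rewrite memA exprMn => /eqP->; rewrite mul1r.
exists (x / y); last by rewrite divfK.
by rewrite memA exprMn exprVn (eqP xy) divff// expf_neq0.
Qed.

Lemma fiber_le k : (fiber k <= t)%N.
Proof.
apply: leq_trans (card_roots_le k.1); apply/subset_leq_card/subsetP => x.
by rewrite !inE => /eqP<-.
Qed.

Lemma card_points_overE K : #|points_over t K| = (\sum_(k in K) fiber k)%N.
Proof.
rewrite -sum1_card (partition_big (kappa t) (mem K)) /=; last by move=> x; rewrite inE.
apply: eq_bigr => k kK; rewrite /fiber -sum1_card; apply: eq_bigl => x.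
by rewrite !inE andb_idl// => /eqP->.
Qed.

(* x and x - d both lie in A iff y = x / d lies over pole d. *)
Definition pole (d : F) : F * F := (d^-1 ^+ t, (- d^-1) ^+ t).

Lemma repsE d : d != 0 -> reps d = fiber (pole d).
Proof.
move=> d0; have d0' : d^-1 != 0 by rewrite invr_neq0.
rewrite /reps -(card_imset _ (mulIf d0')) /fiber; apply: eq_card => y.
rewrite inE; apply/imsetP/idP => [[x]|/eqP[e1 e2]].
  rewrite inE !memA => /andP[/eqP x1 /eqP x2] ->; apply/eqP; congr pair.
    by rewrite exprMn x1 mul1r.
  have -> : 1 - x / d = (x - d) * (- d^-1) by rewrite mulrN mulrBl divff// opprB.
  by rewrite exprMn x2 mul1r.
exists (y * d); last by rewrite mulfK.
rewrite inE !memA exprMn e1 exprVn mulVf ?expf_neq0// eqxx /=.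
have -> : y * d - d = (1 - y) * (- d) by ring.
by rewrite exprMn e2 -exprMn mulrNN mulVf// expr1n.
Qed.

Lemma reps0 : reps 0 = t.
Proof. by rewrite -[RHS]cardA; apply: eq_card => x; rewrite !inE subr0 andbb. Qed.

Lemma reps_pow d d' : d ^+ t = d' ^+ t -> reps d = reps d'.
Proof.
move=> e; have [d0|d0] := eqVneq d 0.
  have /eqP : d' ^+ t = 0 by rewrite -e d0 expr0n gtn_eqF.
  by rewrite expf_eq0 => /andP[_ /eqP->]; rewrite d0.
have d0' : d' != 0.
  by apply: contraNneq d0 => d0'; move/eqP: e; rewrite d0' [X in _ == X]expr0n gtn_eqF// expf_eq0 => /andP[].
rewrite !repsE//; congr fiber; rewrite /pole -mulN1r -[in RHS]mulN1r !exprMn !exprVn.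
by rewrite e.
Qed.

Lemma sum_reps (g : F -> nat) :
  (\sum_(x in A) \sum_(z in A) g (x - z)%R = \sum_d reps d * g d)%N.
Proof.
transitivity (\sum_(x in A) \sum_(d | (x - d)%R \in A) g d)%N.
  apply: eq_bigr => x xA; rewrite [RHS](reindex_inj (inv_inj (subKr x))) /=.
  by apply: eq_bigl => z; rewrite subKr.
rewrite (exchange_big_dep xpredT) //=; apply: eq_bigr => d _.
by rewrite sum_nat_const; congr (_ * _)%N; apply: eq_card => x; rewrite !inE.
Qed.

(** For fixed x and z, a solution of x + y = z + w is given by w alone, with y = w - (x - z)
    required to lie in A. *)
Lemma energyE : additive_energy A = (\sum_(x in A) \sum_(z in A) reps (x - z)%R)%N.
Proof.
rewrite pair_big /= /additive_energy -sum1_card.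
rewrite (partition_big (fun q : F * F * F * F => (q.1.1.1, q.1.2))
  (fun xz => (xz.1 \in A) && (xz.2 \in A))) /=; last first.
  by move=> [[[x y] z] w]; rewrite inE => /and5P[-> _ ->].
apply: eq_bigr => -[x z] /= /andP[xA zA].
have inj : injective (fun w => (x, w - (x - z), z, w)) by move=> w w' [].
rewrite /reps -(card_imset _ inj) sum1_card; apply: eq_card => -[[[x' y] z'] w].
rewrite unfold_in /= inE; apply/idP/imsetP => [|[w' +[-> -> -> ->]]]; last first.
  by rewrite inE xA zA /= => /andP[-> ->]; rewrite eqxx andbT /=; apply/eqP; ring.
move=> /andP[/and5P[_ yA _ wA /eqP e] /eqP[ex ez]]; subst x' z'.
have ey : y = w - (x - z) by apply: (addrI x); rewrite e; ring.
by exists w; rewrite ?inE ?wA -?ey.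
Qed.

Section Rich.
Variable v0 : nat.

(** The threshold frees Stepanov's bound from its size restriction: for suitable [v0] it holds for
    every subset of [rich]. Excluding zero coordinates makes such subsets [zero_free]. *)
Definition rich : {set F * F} := [set k | [&& k.1 != 0, k.2 != 0 & (v0 <= fiber k)%N]].

(* A larger K would contain a set of exactly k0 pairs, with too many points over it. *)
Lemma rich_points_over_bound (p k0 : nat) (K : {set F * F}) : p \in [pchar F] ->
  (16 * k0 <= t ^ 2)%N -> (16 * k0 * t ^ 4 <= p ^ 3)%N ->
  (125 * 256 * t ^ 2 < v0 ^ 3 * k0)%N ->
  K \subset rich -> (#|points_over t K| ^ 3 <= 125 * 256 * (#|K| * t) ^ 2)%N.
Proof.
move=> charF k0t k0p v0k0.
have small (K' : {set F * F}) : K' \subset rich -> (#|K'| <= k0)%N ->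
    (#|points_over t K'| ^ 3 <= 125 * 256 * (#|K'| * t) ^ 2)%N.
  move=> /subsetP KG Kk; apply: (stepanov charF t0).
  - by move=> k /KG; rewrite inE => /and3P[-> ->].
  - by apply: leq_trans k0t; rewrite leq_mul2l Kk orbT.
  - by apply: leq_trans k0p; rewrite leq_mul2r leq_mul2l Kk !orbT.
move=> KG; apply: (small K KG); rewrite leqNgt; apply/negP => /ltnW kK.
pose K' := [set:: take k0 (enum K)].
have K'K : K' \subset K.
  by apply/subsetP => k; rewrite inE => /mem_take; rewrite mem_enum.
have cK' : #|K'| = k0.
  by rewrite cardsE (card_uniqP _) ?take_uniq ?enum_uniq// size_takel// -cardE.
have := small _ (subset_trans K'K KG); rewrite cK' leqnn => /(_ isT).
apply/negP; rewrite -ltnNge.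
have h : (k0 * v0 <= #|points_over t K'|)%N.
  rewrite card_points_overE -cK' -sum_nat_const; apply: leq_sum => k kK'.
  by have := subsetP KG _ (subsetP K'K _ kK'); rewrite inE => /and3P[].
have k00 : (0 < k0)%N by case: (k0) v0k0 => //; rewrite muln0.
apply: (@leq_trans ((k0 * v0) ^ 3)%N); last by rewrite leq_exp2r.
have -> : (125 * 256 * (k0 * t) ^ 2 = k0 ^ 2 * (125 * 256 * t ^ 2))%N by rewrite expnMn mulnCA.
have -> : ((k0 * v0) ^ 3 = k0 ^ 2 * (v0 ^ 3 * k0))%N.
  by rewrite expnMn (expnSr k0 2) -mulnA (mulnC k0).
by rewrite ltn_pmul2l// expn_gt0 k00.
Qed.

Hypothesis rich_points_over : forall K : {set F * F}, K \subset rich ->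
  (#|points_over t K| ^ 3 <= 125 * 256 * (#|K| * t) ^ 2)%N.

(** At least |K| v points lie over the level set K; comparing with Stepanov's upper bound, a factor
    |K|^2 cancels. *)
Lemma rich_level v : (v ^ 3 * #|[set k in rich | (v <= fiber k)%N]| <= 125 * 256 * t ^ 2)%N.
Proof.
set K := [set k in _ | _]; have [K0|K0] := posnP #|K|; first by rewrite K0 muln0.
have KG : K \subset rich by apply/subsetP => k; rewrite inE => /andP[].
have h : (#|K| * v <= #|points_over t K|)%N.
  rewrite card_points_overE -sum_nat_const; apply: leq_sum => k.
  by rewrite inE => /andP[].
have : ((#|K| * v) ^ 3 <= 125 * 256 * (#|K| * t) ^ 2)%N.
  by apply: leq_trans (rich_points_over KG); rewrite leq_exp2r.
have -> : (125 * 256 * (#|K| * t) ^ 2 = #|K| ^ 2 * (125 * 256 * t ^ 2))%N by rewrite expnMn mulnCA.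
have -> : ((#|K| * v) ^ 3 = #|K| ^ 2 * (v ^ 3 * #|K|))%N.
  by rewrite expnMn (expnSr #|K| 2) -mulnA (mulnC #|K|).
by rewrite leq_pmul2l// expn_gt0 K0.
Qed.

Definition rich_reps : {set F} := [set d | (d != 0) && (v0 <= reps d)%N].

(** The pole of d fixes the t-th power of 1/d, so [pole] is at most t-to-one. *)
Lemma card_pole_le (D : {set F}) : 0 \notin D -> (#|D| <= #|pole @: D| * t)%N.
Proof.
move=> D0; rewrite -sum1_card (partition_big pole (mem (pole @: D))) /=; last first.
  by move=> d dD; exact: imset_f.
rewrite -sum_nat_const; apply: leq_sum => k _; rewrite sum1_card.
rewrite -(card_imset _ (@invr_inj F)).
apply: leq_trans (card_roots_le k.1); apply/subset_leq_card/subsetP => _ /imsetP[d + ->].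
by rewrite unfold_in inE => /andP[_ /eqP<-].
Qed.

Lemma rich_reps_level v :
  (v ^ 3 * #|[set d in rich_reps | (v <= reps d)%N]| <= 125 * 256 * t ^ 3)%N.
Proof.
set D := [set d in _ | _].
have D0 : 0 \notin D by rewrite !inE eqxx.
have PD : pole @: D \subset [set k in rich | (v <= fiber k)%N].
  apply/subsetP => _ /imsetP[d + ->]; rewrite !inE => /andP[/andP[d0 vd] vd'].
  by rewrite -!repsE// vd vd' /= !expf_neq0// ?oppr_eq0 invr_neq0.
apply: (@leq_trans (v ^ 3 * (#|[set k in rich | (v <= fiber k)%N]| * t))).
  rewrite leq_mul2l (leq_trans (card_pole_le D0)) ?orbT//.
  by rewrite leq_mul2r subset_leq_card ?orbT.
by rewrite mulnA (expnSr t 2) mulnA leq_mul2r rich_level orbT.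
Qed.

End Rich.
End LevelSets.

Lemma leq_sum_subset (I : finType) (X Y : {set I}) (g : I -> nat) : X \subset Y ->
  (\sum_(i in X) g i <= \sum_(i in Y) g i)%N.
Proof. by move=> XY; rewrite [X in (_ <= X)%N](big_setID X) /= (setIidPr XY) leq_addr. Qed.

Lemma leq_mul_sqr_cubes a b : (a * b ^ 2 <= a ^ 3 + b ^ 3)%N.
Proof.
case: (leqP a b) => ab.
  by apply: (leq_trans _ (leq_addl _ _)); rewrite (expnS b 2); exact: leq_mul.
apply: (leq_trans _ (leq_addr _ _)); rewrite (expnS a 2); apply: leq_mul => //.
by rewrite leq_exp2r// ltnW.
Qed.

(** * Pairs (x, z) whose ratio (z+1)/(x+1) lies over a rich pair *)

Section HighPairs.
Variables (F : finFieldType) (t : nat) (A : {set F}).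
Hypothesis t0 : (0 < t)%N.
Hypothesis memA : forall x, (x \in A) = (x ^+ t == 1).
Hypothesis cardA : #|A| = t.

Notation fiber := (@fiber F t).
Notation reps := (@reps F A).
Notation S := (sumset A A).

Lemma one_in : 1 \in A. Proof. by rewrite memA expr1n. Qed.

Definition shifts (r : F) : nat := #|[set x in A | r * (x + 1) - 1 \in A]|.

(* If r (x + 1) = z + 1 with x, z in A, then w = z / (r - 1) lies over dual_pair (kappa t r). *)
Definition dual_pair (k : F * F) : F * F := (((-1) ^+ t * k.2)^-1, k.1 / k.2).

Lemma shiftsE r : r != 0 -> r != 1 -> shifts r = fiber (dual_pair (kappa t r)).
Proof.
move=> r0 r1; have r1' : r - 1 != 0 by rewrite subr_eq0.
have r1'' : 1 - r != 0 by rewrite subr_eq0 eq_sym.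
have inj : injective (fun x => (r * (x + 1) - 1) / (r - 1)).
  by move=> x y /(mulIf (invr_neq0 r1')) /addIr /(mulfI r0) /addIr.
have tw : dual_pair (kappa t r) = (((r - 1)^-1) ^+ t, (r / (1 - r)) ^+ t).
  by rewrite /dual_pair /kappa /= -exprMn mulN1r opprB exprVn exprMn exprVn.
rewrite tw /shifts -(card_imset _ inj); apply: eq_card => w.
rewrite inE; apply/imsetP/eqP => [[x]|[e1 e2]].
  rewrite inE !memA => /andP[/eqP x1 /eqP z1] ->; congr pair.
    by rewrite exprMn z1 mul1r.
  have -> : 1 - (r * (x + 1) - 1) / (r - 1) = r / (1 - r) * x by field; apply/andP.
  by rewrite exprMn x1 mulr1.
exists ((1 - w) * ((1 - r) / r)); last by field; apply/andP.
have rr : r / (1 - r) * ((1 - r) / r) = 1 by field; apply/andP.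
rewrite inE !memA exprMn e2 -exprMn rr expr1n eqxx /=.
have -> : r * ((1 - w) * ((1 - r) / r) + 1) - 1 = w * (r - 1) by field.
by rewrite exprMn e1 -exprMn mulVf// expr1n.
Qed.

Lemma dual_pair_inj : {in [pred k | k.2 != 0] &, injective dual_pair}.
Proof.
move=> [a b] [c d]; rewrite !inE /= => b0 d0 [/invr_inj].
move=> /mulfI; rewrite expf_neq0 ?oppr_eq0 ?oner_eq0// => /(_ isT) bd.
by rewrite bd => /(mulIf (invr_neq0 d0)) ->.
Qed.

Lemma kappa_neq (r : F) : (kappa t r).1 != 0 -> (kappa t r).2 != 0 -> (r != 0) /\ (r != 1).
Proof.
rewrite /kappa /= !expf_eq0 t0 /= => r0; rewrite subr_eq0 eq_sym => r1.
by split.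
Qed.

Section Rich.
Variable v0 : nat.
Notation rich := (@rich F t v0).

Lemma sum_shifts :
  (\sum_(r in points_over t rich) shifts r ^ 2 <= 2 * \sum_(k in rich) fiber k ^ 3)%N.
Proof.
have -> : (\sum_(r in points_over t rich) shifts r ^ 2 =
           \sum_(k in rich) fiber k * fiber (dual_pair k) ^ 2)%N.
  rewrite (partition_big (kappa t) (mem rich)) /=; last by move=> r; rewrite inE.
  apply: eq_bigr => k kG; rewrite {1}/fiber -sum1_card big_distrl /=.
  apply: eq_big => r; rewrite [r \in points_over _ _]inE.
    by rewrite [RHS]inE andb_idl// => /eqP->.
  move=> /andP[+ /eqP kr]; rewrite -kr inE => /and3P[r0 r1 _].
  have [r0' r1'] := kappa_neq r0 r1.
  by rewrite shiftsE// mul1n.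
rewrite mul2n -addnn.
apply: (@leq_trans (\sum_(k in rich) (fiber k ^ 3 + (dual_pair k \in rich) * fiber (dual_pair k) ^ 3))%N).
  apply: leq_sum => k; rewrite {1}inE => /and3P[k1 k2 vk]; case: (boolP (dual_pair k \in rich)) => [_|].
  - by rewrite -[(true * _)%N]/(1 * _)%N mul1n leq_mul_sqr_cubes.
  - rewrite inE /= invr_eq0 !mulf_eq0 expf_eq0 oppr_eq0 oner_eq0 andbF /=.
    rewrite invr_eq0 (negPf k1) (negPf k2) /= -ltnNge => b; rewrite mul0n addn0.
    rewrite (expnS (fiber k) 2); apply: leq_mul => //.
    by rewrite leq_exp2r// (leq_trans (ltnW b)).
rewrite big_split leq_add2l /=.
have -> : (\sum_(k in rich) (dual_pair k \in rich) * fiber (dual_pair k) ^ 3 =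
           \sum_(k in [set k in rich | dual_pair k \in rich]) fiber (dual_pair k) ^ 3)%N.
  rewrite -(eq_bigl _ _ (fun k => esym (in_set _ k))) big_mkcondr /=.
  by apply: eq_bigr => k _; case: (dual_pair k \in rich); rewrite ?mul1n.
rewrite -(big_imset (fun k => fiber k ^ 3)%N); last first.
  move=> k k' /=; rewrite inE => /andP[+ _]; rewrite inE => /and3P[_ k2 _].
  by rewrite inE => /andP[+ _]; rewrite inE => /and3P[_ k2' _]; exact: (dual_pair_inj k2 k2').
apply: leq_sum_subset; apply/subsetP => _ /imsetP[k + ->].
by rewrite inE => /andP[].
Qed.

(** X is a union of cosets of A not containing 0, each with exactly t elements and a single t-th
    power. *)
Lemma card_pow_image (X : {set F}) : 0 \notin X ->
  (forall x y, x \in X -> y ^+ t = x ^+ t -> y \in X) ->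
  (#|[set x ^+ t | x in X]| * t <= #|X|)%N.
Proof.
move=> X0 Xinv; rewrite -[X in (_ <= X)%N]sum1_card.
rewrite (partition_big (fun x => x ^+ t) (mem [set x ^+ t | x in X])) /=; last first.
  by move=> x xX; exact: imset_f.
rewrite -sum_nat_const; apply: leq_sum => _ /imsetP[x xX ->].
have x0 : x != 0 by apply: contraNneq X0 => <-.
rewrite sum1_card -[X in (X <= _)%N](card_roots_eq memA cardA x0); apply/subset_leq_card/subsetP => y.
by rewrite inE => /eqP e; apply/andP; split; [exact: Xinv xX e|exact/eqP].
Qed.

(** The quotient y / x lies in A, and multiplying a sum of two elements of A by an element of A
    gives another such sum. *)
Lemma sumset_pow x y : x \in S -> y ^+ t = x ^+ t -> y \in S.
Proof.
have [->|x0] := eqVneq x 0.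
  by move=> h /eqP; rewrite [X in _ == X]expr0n gtn_eqF// expf_eq0 => /andP[_ /eqP->].
move=> /imset2P[a b aA bA xE] e; apply/imset2P.
have cA : y / x \in A by rewrite memA exprMn exprVn e divff// expf_neq0.
exists (a * (y / x)) (b * (y / x)).
- by rewrite memA exprMn; move: aA cA; rewrite !memA => /eqP-> /eqP->; rewrite mulr1.
- by rewrite memA exprMn; move: bA cA; rewrite !memA => /eqP-> /eqP->; rewrite mulr1.
- by rewrite -mulrDl -xE mulrC divfK.
Qed.

Definition high_pairs (u : nat) : {set F * F} :=
  [set q in setX A A | (kappa t ((q.2 + 1) / (q.1 + 1)) \in rich) &&
                       (u <= reps (q.1 - q.2)%R)%N].

Lemma high_pairsP u q : q \in high_pairs u ->
  [/\ q.1 \in A, q.2 \in A & (u <= reps (q.1 - q.2)%R)%N] /\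
  [/\ q.1 + 1 != 0, q.2 + 1 != 0, q.1 != q.2 &
      kappa t ((q.2 + 1) / (q.1 + 1)) \in rich].
Proof.
case: q => x z; rewrite !inE /= => /andP[/andP[xA zA] /andP[kG ux]].
split=> //; have /and3P[k1 k2 _] := kG.
have [r0 r1] := kappa_neq k1 k2.
have x1 : x + 1 != 0 by apply: contraNneq r0 => ->; rewrite invr0 mulr0.
have z1 : z + 1 != 0 by apply: contraNneq r0 => ->; rewrite mul0r.
by split=> //; apply: contraNneq r1 => ->; rewrite divff.
Qed.

Hypothesis rich_points_over : forall K : {set F * F}, K \subset rich ->
  (#|points_over t K| ^ 3 <= 125 * 256 * (#|K| * t) ^ 2)%N.

(** Cauchy-Schwarz over the ratio r bounds the square of the count by the number of points over K
    times the second moment of [shifts]; Stepanov's bound handles the points. Counting cosets gives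
    |K| t^3 <= |2A|^2 |Q|, and |Q| u^2 is at most the second moment of [reps]. Sixth powers keep
    everything integral. *)
Lemma high_pairs_bound u :
  (#|high_pairs u| ^ 6 * (u ^ 4 * t ^ 4) <=
   125 * 256 * (2 * \sum_(k in rich) fiber k ^ 3) ^ 3 *
   (#|S| ^ 2 * \sum_(d | d != 0%R) reps d ^ 2) ^ 2)%N.
Proof.
pose pow := fun x : F => x ^+ t.
pose S' := S :\ 0.
pose Q := [set d | (d != 0) && (u <= reps d)%N].
(* With r = (z+1)/(x+1) one has 1 - r = (x-z)/(x+1); both x + 1 and z + 1 lie in 2A because 1 is in
   A. *)
pose K := rich :&: [set (q.1.2 / q.1.1, q.2 / q.1.1)
  | q in setX (setX (pow @: S') (pow @: S')) (pow @: Q)].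
have KG : K \subset rich by apply: subsetIl.
have cS' : (#|pow @: S'| * t <= #|S|)%N.
  apply: (@leq_trans #|S'|); last by apply: subset_leq_card; apply: subsetDl.
  apply: card_pow_image; first by rewrite !inE eqxx.
  move=> x y; rewrite !inE => /andP[x0 xS] e; rewrite (sumset_pow xS e) andbT.
  by apply: contraNneq x0 => y0; move/eqP: e; rewrite y0 expr0n gtn_eqF// eq_sym expf_eq0 => /andP[].
have cQ : (#|pow @: Q| * t <= #|Q|)%N.
  apply: card_pow_image; first by rewrite !inE eqxx.
  move=> x y; rewrite !inE => /andP[x0 xS] e; rewrite (reps_pow t0 memA e) xS andbT.
  by apply: contraNneq x0 => y0; move/eqP: e; rewrite y0 expr0n gtn_eqF// eq_sym expf_eq0 => /andP[].
have uQ : (#|Q| * u ^ 2 <= \sum_(d | d != 0%R) reps d ^ 2)%N.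
  rewrite -sum_nat_const (@leq_trans (\sum_(d in Q) reps d ^ 2)%N)//.
    by apply: leq_sum => d; rewrite inE => /andP[_ ud]; rewrite leq_exp2r.
  apply: (@leq_trans (\sum_(d in [set d : F | d != 0%R]) reps d ^ 2)%N).
    by apply: leq_sum_subset; apply/subsetP => d; rewrite !inE => /andP[].
  by rewrite leq_eqVlt; apply/orP; left; apply/eqP; apply: eq_bigl => d; rewrite inE.
have cK : (#|K| * t ^ 3 * u ^ 2 <= #|S| ^ 2 * \sum_(d | d != 0%R) reps d ^ 2)%N.
  have : (#|K| <= #|pow @: S'| * #|pow @: S'| * #|pow @: Q|)%N.
    by rewrite -!cardsX (leq_trans (subset_leq_card (subsetIr _ _)))// leq_imset_card.
  move: (\sum_(d | _) _)%N uQ => E'; move: #|K| #|pow @: S'| #|pow @: Q| #|Q| #|S| cS' cQ.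
  clear => k a b c s.
  move=> /(fun h => leq_mul h h) h1 h2 h3 h4; have := leq_mul h1 (leq_trans (leq_mul h2 (leqnn (u ^ 2))) h3).
  apply: leq_trans; rewrite -mulnA (leq_trans (leq_mul h4 (leqnn _)))// !expnS expn0.
  by rewrite leq_eqVlt; apply/orP; left; apply/eqP; ring.
have pairsK : (#|high_pairs u| <= \sum_(r in points_over t K) 1 * shifts r)%N.
  pose rho (q : F * F) := (q.2 + 1) / (q.1 + 1).
  rewrite -sum1_card (partition_big rho (mem (points_over t K))) /=; last first.
    move=> [x z] /high_pairsP /= [[xA zA ux] [x1 z1 xz kG]].
    rewrite inE [_ \in K]inE kG /=.
    have ES y : y \in A -> y + 1 \in S by move=> yA; apply/imset2P; exists y 1; rewrite ?one_in.
    apply/imsetP; exists (pow (x + 1), pow (z + 1), pow (x - z)).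
      by rewrite !inE /= !imset_f ?inE ?x1 ?z1 ?ES ?subr_eq0 ?xz ?ux.
    rewrite /kappa /rho /pow /= -!exprVn -!exprMn; congr (_, _ ^+ _).
    by field.
  apply: leq_sum => r _; rewrite mul1n sum1_card /shifts.
  have inj : {in [pred q | (q \in high_pairs u) && (rho q == r)] &, injective (@fst F F)}.
    move=> [x z] [x' z'] /andP[/high_pairsP /= [_ [x1 _ _ _]] /eqP e].
    move=> /andP[/high_pairsP /= [_ [x1' _ _ _]] /eqP e'] ex; subst x'; congr pair.
    by move: e; rewrite -e' /rho /= => /(mulIf (invr_neq0 x1)) /addIr.
  rewrite -(card_in_imset inj); apply/subset_leq_card/subsetP => _ /imsetP[[x z] h ->].
  move: h => /andP[/high_pairsP /= [[xA zA _] [x1 _ _ _]] /eqP <-].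
  by rewrite inE xA /rho /= divfK// addrK.
have CS : (#|high_pairs u| ^ 2 <= #|points_over t K| * (2 * \sum_(k in rich) fiber k ^ 3))%N.
  apply: (@leq_trans ((\sum_(r in points_over t K) 1 * shifts r) ^ 2)%N); first by rewrite leq_exp2r.
  apply: (leq_trans (nat_cauchy_schwarz _ _ _)); rewrite sum1_card.
  rewrite leq_mul2l (leq_trans _ sum_shifts) ?orbT//; apply: leq_sum_subset.
  by apply/subsetP => r; rewrite !inE => /andP[].
have N3 := rich_points_over KG.
move: (2 * _)%N CS => Y CS.
move: (_ ^ 2 * _)%N cK => Z; move: #|high_pairs u| #|points_over t K| #|K| CS N3.
clear => P N k CS N3 cK.
(* Writing M = 125 * 256, one has P^6 <= N^3 Y^3 and N^3 <= M (k t)^2; the factor u^4 t^4 completes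
   (k t)^2 to (k t^3 u^2)^2 <= Z^2. *)
have h1 : (P ^ 6 <= N ^ 3 * Y ^ 3)%N by rewrite -expnMn -[6%N]/(2 * 3)%N expnM leq_exp2r.
have h2 : ((k * t ^ 3 * u ^ 2) ^ 2 <= Z ^ 2)%N by rewrite leq_exp2r.
apply: (leq_trans (leq_mul h1 (leqnn _))).
apply: (leq_trans (leq_mul (leq_mul N3 (leqnn _)) (leqnn _))).
apply: leq_trans (leq_mul (leqnn _) h2).
by rewrite leq_eqVlt; apply/orP; left; apply/eqP; move: (125 * 256)%N => M; ring.
Qed.

End Rich.
End HighPairs.

(** * Pairs whose ratio lies over a pair below the threshold *)

Section LowPairs.
Variables (F : finFieldType) (t : nat) (A : {set F}).
Hypothesis t0 : (0 < t)%N.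
Hypothesis memA : forall x, (x \in A) = (x ^+ t == 1).
Hypothesis cardA : #|A| = t.
Variable v0 : nat.

Notation fiber := (@fiber F t).
Notation reps := (@reps F A).
Notation S := (sumset A A).

Definition low (s u : F) : nat :=
  if [&& s != 0, u != 0, s != u & (fiber (kappa t (u / s)) < v0)%N]
  then reps (s - u) else 0%N.

Definition low_sum : nat := (\sum_(x in A) \sum_(z in A) low (x + 1)%R (z + 1)%R)%N.

Definition common (s u : F) : nat := #|[set y in A | (s - y \in A) && (u - y \in A)]|.

Lemma mulA_mem x y : y \in A -> (x * y \in A) = (x \in A).
Proof. by rewrite !memA exprMn => /eqP->; rewrite mulr1. Qed.

Lemma low_mul s u y : y \in A -> low (s * y) (u * y) = low s u.
Proof.
move=> yA; have y0 := memA_neq0 t0 memA yA.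
rewrite /low !mulf_eq0 (negPf y0) !orbF (inj_eq (mulIf y0)) -mulf_div divff// mulr1.
case: ifP => // _; apply: (reps_pow t0 memA).
by move: yA; rewrite memA -mulrBl exprMn => /eqP->; rewrite mulr1.
Qed.

(** For y in A, [low] is unchanged when both arguments are multiplied by y, and (x+1) y = x y + y
    where x y again runs over A. Each of the t choices of y thus gives the same sum, and (s, u)
    occurs once for every y with s - y and u - y in A. *)
Lemma low_sumE :
  (t * low_sum = \sum_(q | (q.1 \in S) && (q.2 \in S)) common q.1 q.2 * low q.1 q.2)%N.
Proof.
transitivity (\sum_(y in A) \sum_(q | (q.1 \in A) && (q.2 \in A)) low (q.1 + 1)%R (q.2 + 1)%R)%N.
  by rewrite sum_nat_const cardA /low_sum pair_big.
transitivity (\sum_(y in A) \sum_(q | [&& q.1 \in S, q.2 \in S, (q.1 - y)%R \in A & (q.2 - y)%R \in A])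
    low q.1 q.2)%N; last first.
  rewrite (exchange_big_dep (fun q => (q.1 \in S) && (q.2 \in S))) /=; last first.
    by move=> y q _ /and4P[-> ->].
  apply: eq_bigr => q /andP[q1 q2]; rewrite sum_nat_const; congr (_ * _)%N.
  by apply: eq_card => y; rewrite !inE unfold_in q1 q2.
apply: eq_bigr => y yA; have y0 := memA_neq0 t0 memA yA.
rewrite [RHS](reindex (fun q : F * F => ((q.1 + 1) * y, (q.2 + 1) * y))) /=; last first.
  exists (fun q : F * F => (q.1 / y - 1, q.2 / y - 1)) => -[a b] _ /=.
    by rewrite !mulfK// !addrK.
  by rewrite !subrK !divfK.
have cond a : ((a + 1) * y \in S) && ((a + 1) * y - y \in A) = (a \in A).
  have -> : (a + 1) * y - y = a * y by ring.
  rewrite mulA_mem//; case: (boolP (a \in A)) => aA; rewrite ?andbF// andbT.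
  apply/imset2P; exists (a * y) y => //; first by rewrite mulA_mem.
  by ring.
apply: eq_big => [[a b]|[a b] _] /=; last by rewrite low_mul.
by rewrite -(cond a) -(cond b); do ![case: (_ \in _)].
Qed.

(** The square of [common] counts y, y' with s - y, s - y', u - y, u - y' all in A. For fixed y, y'
    the choices of s and u are independent, with [reps (y - y')] possibilities each. *)
Lemma sum_common_sqr :
  (\sum_(q | (q.1 \in S) && (q.2 \in S)) common q.1 q.2 ^ 2 <= \sum_d reps d ^ 3)%N.
Proof.
apply: (@leq_trans (\sum_q common q.1 q.2 ^ 2)%N).
  by rewrite [X in (_ <= X)%N](bigID (fun q => (q.1 \in S) && (q.2 \in S))) /= leq_addr.
have -> : (\sum_d reps d ^ 3 = \sum_(y in A) \sum_(y' in A) reps (y - y')%R ^ 2)%N.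
  by rewrite (sum_reps A (fun d => reps d ^ 2)%N); apply: eq_bigr => d _; rewrite expnS.
have cE (q : F * F) : (common q.1 q.2 ^ 2 = \sum_(y in A) \sum_(y' in A)
   ([&& (q.1 - y)%R \in A, (q.1 - y')%R \in A, (q.2 - y)%R \in A & (q.2 - y')%R \in A]))%N.
  have -> : common q.1 q.2 = (\sum_(y in A) ((q.1 - y)%R \in A) && ((q.2 - y)%R \in A))%N.
    rewrite /common -sum1_card big_mkcond [RHS]big_mkcond /=; apply: eq_bigr => y _.
    by rewrite inE; case: (y \in A) => //=; case: (_ && _).
  rewrite -mulnn big_distrlr /=; apply: eq_bigr => y _; apply: eq_bigr => y' _.
  by do ![case: (_ \in _)].
under eq_bigr => q _ do rewrite cE.
rewrite exchange_big /=; apply: leq_sum => y _; rewrite exchange_big /=; apply: leq_sum => y' _.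
rewrite -(pair_bigA _ (fun s u => nat_of_bool [&& (s - y)%R \in A, (s - y')%R \in A, (u - y)%R \in A & (u - y')%R \in A])) /=.
have -> : reps (y - y') = (\sum_s ((s - y)%R \in A) && ((s - y')%R \in A))%N.
  have -> : reps (y - y') = #|[set x in A | x - (y - y') \in A]| by [].
  rewrite -sum1_card big_mkcond /= (reindex_inj (addIr (- y'))) /=.
  apply: eq_bigr => s _; rewrite inE.
  have -> : s - y' - (y - y') = s - y by ring.
  by do ![case: (_ \in _)].
rewrite -mulnn big_distrlr /=; apply: leq_sum => s _; apply: leq_sum => u _.
by do ![case: (_ \in _)].
Qed.

Definition compatible (s u u' d : F) : bool :=
  [&& s != 0, (fiber (kappa t (u / s)) < v0)%N, u ^+ t == u' ^+ t & (s - u) ^+ t == d ^+ t].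

(* r(s - u) depends only on the coset of s - u, and S is a union of cosets: u and
   s - u may be replaced by any of the t elements of their cosets. *)
Lemma low_sqr_le s u : u \in S ->
  (t ^ 2 * low s u ^ 2 <= \sum_(u' in S) \sum_(d | d != 0%R) compatible s u u' d * reps d ^ 2)%N.
Proof.
move=> uS; rewrite /low; case: ifP => [/and4P[s0 u0 su lowf]|_]; last by rewrite muln0.
have su0 : s - u != 0 by rewrite subr_eq0.
apply: (@leq_trans (\sum_(u' in [set u' | u' ^+ t == u ^+ t])
   \sum_(d in [set d | d ^+ t == (s - u)%R ^+ t]) reps (s - u)%R ^ 2)%N).
  by rewrite !sum_nat_const !(card_roots_eq memA cardA)// mulnA mulnn.
rewrite [X in (_ <= X)%N](bigID (mem [set u' | u' ^+ t == u ^+ t])) /= (leq_trans _ (leq_addr _ _))//.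
rewrite [X in (_ <= X)%N](eq_bigl (mem [set u' | u' ^+ t == u ^+ t])) => [|u']; last first.
  by rewrite andb_idl// inE => /eqP e; exact: (sumset_pow t0 memA uS e).
apply: leq_sum => u'; rewrite inE => /eqP eu.
rewrite [X in (_ <= X)%N](bigID (mem [set d | d ^+ t == (s - u)%R ^+ t])) /= (leq_trans _ (leq_addr _ _))//.
rewrite [X in (_ <= X)%N](eq_bigl (mem [set d | d ^+ t == (s - u)%R ^+ t])) => [|d]; last first.
  rewrite andb_idl// inE => /eqP e; apply: contraNneq su0 => d0.
  by move/eqP: e; rewrite d0 expr0n gtn_eqF// eq_sym expf_eq0 => /andP[].
apply: leq_sum => d; rewrite inE => /eqP ed.
by rewrite /compatible s0 lowf eu ed !eqxx /= mul1n (reps_pow t0 memA ed).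
Qed.

(** Fixing s, u' and d fixes the cosets of u and s - u, so every u / s lies over one and the same
    pair, whose fiber is below the threshold. *)
Lemma sum_compatible_le s u' d : (\sum_(u in S) compatible s u u' d <= v0)%N.
Proof.
have -> : (\sum_(u in S) compatible s u u' d = #|[set u in S | compatible s u u' d]|)%N.
  rewrite -sum1_card big_mkcond [RHS]big_mkcond /=; apply: eq_bigr => u _.
  by rewrite inE; case: (u \in S) => //=; case: compatible.
have [->|[u1]] := set_0Vmem [set u in S | compatible s u u' d]; first by rewrite cards0.
rewrite inE => /andP[_ /and4P[s0 fu1 /eqP e1 /eqP e2]].
apply: leq_trans (ltnW fu1); rewrite -(card_imset _ (mulIf (invr_neq0 s0))).
apply/subset_leq_card/subsetP => _ /imsetP[u uin ->].
have /andP[_ /and4P[_ _ /eqP e1' /eqP e2']] : (u \in S) && compatible s u u' d by rewrite inE in uin.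
have sub v : 1 - v / s = (s - v) / s by rewrite mulrBl divff.
by rewrite inE /kappa !sub !exprMn e1 e1' e2 e2'.
Qed.

Lemma sum_low_sqr :
  (t ^ 2 * \sum_(q | (q.1 \in S) && (q.2 \in S)) low q.1 q.2 ^ 2 <=
   v0 * #|S| ^ 2 * \sum_(d | d != 0%R) reps d ^ 2)%N.
Proof.
rewrite -(pair_big _ _ (fun s u => low s u ^ 2)%N) /= big_distrr /=.
apply: (@leq_trans (\sum_(s in S) \sum_(u' in S) \sum_(d | d != 0%R) v0 * reps d ^ 2)%N); last first.
  by rewrite -big_distrr !sum_nat_const /= mulnA mulnn mulnCA mulnA.
apply: leq_sum => s _; rewrite big_distrr /=.
apply: (@leq_trans (\sum_(u in S) \sum_(u' in S) \sum_(d | d != 0%R) compatible s u u' d * reps d ^ 2)%N).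
  by apply: leq_sum => u uS; exact: low_sqr_le.
rewrite exchange_big /=; apply: leq_sum => u' _.
rewrite exchange_big /=; apply: leq_sum => d _.
by rewrite -big_distrl leq_mul2r sum_compatible_le orbT.
Qed.

(** Cauchy-Schwarz in [low_sumE], separating [common] from [low]. *)
Lemma low_energy :
  (t ^ 4 * low_sum ^ 2 <= (\sum_d reps d ^ 3) *
     (v0 * #|S| ^ 2 * \sum_(d | d != 0%R) reps d ^ 2))%N.
Proof.
have -> : (t ^ 4 * low_sum ^ 2 = t ^ 2 * (t * low_sum) ^ 2)%N by rewrite expnMn mulnA -expnD.
rewrite low_sumE; apply: leq_trans (leq_mul sum_common_sqr sum_low_sqr).
by rewrite mulnCA leq_mul2l nat_cauchy_schwarz orbT.
Qed.

Lemma energy_sum_sqr : (additive_energy A = t ^ 2 + \sum_(d | d != 0%R) reps d ^ 2)%N.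
Proof.
rewrite energyE sum_reps (bigD1 0)//= (reps0 cardA); congr addn.
Qed.

(** The degenerate cases x = z, x = -1 and z = -1 cost t^2 each. Any other pair is low, or has at
    least T representations (the tail), or is a high pair, where r(x - z) < T is written as the
    number of u < T with u < r(x - z). *)
Lemma energy_decomposition (T : nat) :
  (additive_energy A <= 3 * t ^ 2 + low_sum + \sum_(u < T) #|high_pairs t A v0 u.+1| +
    \sum_(d | (d != 0%R) && (T <= reps d)) reps d ^ 2)%N.
Proof.
rewrite energyE.
pose g d := if (d != 0) && (T <= reps d)%N then reps d else 0%N.
apply: (@leq_trans (\sum_(x in A) \sum_(z in A) (t * (x == z) + t * (x == (-1)%R) + t * (z == (-1)%R) +
   low (x + 1)%R (z + 1)%R + \sum_(u < T) ((x, z) \in high_pairs t A v0 u.+1) + g (x - z)%R))%N).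
  apply: leq_sum => x xA; apply: leq_sum => z zA.
  have dt : (reps (x - z)%R <= t)%N.
    by rewrite -cardA; apply/subset_leq_card/subsetP => y; rewrite inE => /andP[].
  case: (eqVneq x z) => [xz|xz]; first by rewrite muln1 -!addnA (leq_trans dt)// leq_addr.
  case: (eqVneq x (-1)) => [x1|x1]; first by rewrite muln0 muln1 -!addnA (leq_trans dt)// leq_addr.
  case: (eqVneq z (-1)) => [z1|z1]; first by rewrite !muln0 muln1 -!addnA (leq_trans dt)// leq_addr.
  rewrite !muln0 !add0n.
  have x10 : x + 1 != 0 by rewrite addr_eq0.
  have z10 : z + 1 != 0 by rewrite addr_eq0.
  have xz1 : x + 1 != z + 1 by rewrite (inj_eq (addIr 1)).
  rewrite /low x10 z10 xz1 /=; case: ltnP => hv.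
    have -> : x + 1 - (z + 1) = x - z by ring.
    by rewrite -addnA leq_addr.
  rewrite add0n /g subr_eq0 xz /=; case: (leqP T (reps (x - z)%R)) => hT; first by rewrite leq_addl.
  rewrite addn0; have kG : kappa t ((z + 1) / (x + 1)) \in rich F t v0.
    have r0 : (z + 1) / (x + 1) != 0 by rewrite mulf_neq0// invr_neq0.
    have r1 : 1 - (z + 1) / (x + 1) != 0.
      by rewrite subr_eq0 -(inj_eq (mulIf x10)) mul1r divfK.
    by rewrite inE hv /= !(expf_neq0 _ _).
  rewrite (eq_bigr (fun u : 'I_T => nat_of_bool (u < reps (x - z)%R)%N)) => [|u _]; last first.
    by rewrite in_set in_setX /= xA zA kG.
  by rewrite -big_mkcond (big_ord_narrow (ltnW hT)) sum1_card card_ord.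
under eq_bigr => x _ do rewrite !big_split /=.
rewrite !big_split /=.
have e1 : (\sum_(x in A) \sum_(z in A) t * (x == z) <= t ^ 2)%N.
  rewrite -mulnn -{2}cardA -sum_nat_const; apply: leq_sum => x xA.
  by rewrite -big_distrr /= (bigD1 x)//= eqxx big1 ?muln1// => z /andP[_ /negPf]; rewrite eq_sym => ->.
have ind : (\sum_(x in A) (x == (-1)%R) <= 1)%N.
  case: (boolP (-1 \in A)) => h; last by rewrite big1// => x xA; case: eqP => // e; rewrite -e xA in h.
  by rewrite (bigD1 (-1))//= eqxx big1// => z /andP[_ /negPf->].
have e2 : (\sum_(x in A) \sum_(z in A) t * (x == (-1)%R) <= t ^ 2)%N.
  rewrite exchange_big /= sum_nat_const cardA -mulnn leq_mul2l -big_distrr /=.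
  by rewrite -[X in (_ <= X)%N]muln1 leq_mul2l ind !orbT.
have e3 : (\sum_(x in A) \sum_(z in A) t * (z == (-1)%R) <= t ^ 2)%N.
  rewrite sum_nat_const cardA -mulnn leq_mul2l -big_distrr /=.
  by rewrite -[X in (_ <= X)%N]muln1 leq_mul2l ind !orbT.
have e4 : (\sum_(x in A) \sum_(z in A) \sum_(u < T) ((x, z) \in high_pairs t A v0 u.+1) =
   \sum_(u < T) #|high_pairs t A v0 u.+1|)%N.
  rewrite pair_big exchange_big /=; apply: eq_bigr => u _.
  rewrite -sum1_card [RHS]big_mkcond [LHS]big_mkcond /=; apply: eq_bigr => -[x z] _ /=.
  by rewrite in_set in_setX /=; case: (x \in A); case: (z \in A) => //=; case: (_ && _).
have e5 : (\sum_(x in A) \sum_(z in A) g (x - z)%R =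
    \sum_(d | (d != 0%R) && (T <= reps d)) reps d ^ 2)%N.
  rewrite sum_reps [RHS]big_mkcond /=; apply: eq_bigr => d _; rewrite /g.
  by case: ifP; rewrite ?muln0// mulnn.
rewrite e4 e5 !leq_add2r.
rewrite (_ : 3 * t ^ 2 = t ^ 2 + t ^ 2 + t ^ 2)%N; last by lia.
by rewrite !leq_add.
Qed.

End LowPairs.

(** * Numerical optimisation *)

(* k0 is at least 1/32 of min(t^2, p^3 / t^4), and 102^3 > 32 * (125 * 256). *)
Lemma stepanov_params (t p : nat) (k0 := minn (t ^ 2 %/ 16) (p ^ 3 %/ (16 * t ^ 4))) :
  (4 <= t)%N -> (0 < p)%N -> (16 * t ^ 4 <= p ^ 3)%N ->
  [/\ (16 * k0 <= t ^ 2)%N, (16 * k0 * t ^ 4 <= p ^ 3)%N &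
      (125 * 256 * t ^ 2 < (102 * (t ^ 2 %/ p + 1)) ^ 3 * k0)%N].
Proof.
move=> t4 p0 tp.
have t40 : (0 < t ^ 4)%N by rewrite expn_gt0 (leq_trans _ t4).
have d0 : (0 < 16 * t ^ 4)%N by rewrite muln_gt0.
have t16 : (16 <= t ^ 2)%N by rewrite -[16%N]/(4 ^ 2)%N leq_exp2r.
have k00 : (0 < k0)%N by rewrite leq_min !divn_gt0// t16 tp.
split.
- by rewrite (leq_trans _ (leq_trunc_div (t ^ 2) 16))// mulnC leq_mul2r geq_minl orbT.
- rewrite mulnAC mulnC (leq_trans _ (leq_trunc_div (p ^ 3) (16 * t ^ 4)))//.
  by rewrite leq_mul2r geq_minr orbT.
set q := (_ + 1)%N.
have q0 : (0 < q)%N by rewrite /q addn1.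
have tqp : (t ^ 2 <= q * p)%N by rewrite /q addn1 ltnW// ltn_ceil.
set x := (q ^ 3 * k0)%N.
have x0 : (0 < x)%N by rewrite muln_gt0 expn_gt0 q0.
suff : (t ^ 2 <= 32 * x)%N.
  rewrite expnMn -mulnA -/x; move: (t ^ 2)%N => t2; move: x0; clear; lia.
have [e|e] : k0 = (t ^ 2 %/ 16)%N \/ k0 = (p ^ 3 %/ (16 * t ^ 4))%N.
- by rewrite /k0; case: leqP => _; [left|right].
- have h : (t ^ 2 < k0.+1 * 16)%N by rewrite e ltn_ceil.
  have kx : (k0 <= x)%N by rewrite /x leq_pmull// expn_gt0 q0.
  by move: h kx k00; move: (t ^ 2)%N => t2; clear; lia.
have h : (p ^ 3 <= k0 * (32 * t ^ 4))%N.
  have : (p ^ 3 < k0.+1 * (16 * t ^ 4))%N by rewrite e ltn_ceil.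
  by move: k00; move: (p ^ 3)%N (t ^ 4)%N => a b; clear; nia.
rewrite -(leq_pmul2r t40).
apply: (@leq_trans ((q * p) ^ 3)%N).
  by rewrite -expnD (expnM t 2 3) leq_exp2r.
rewrite expnMn /x; apply: (leq_trans (leq_mul (leqnn (q ^ 3)) h)).
by rewrite leq_eqVlt; apply/orP; left; apply/eqP; ring.
Qed.

(** * Real sums and logarithms *)

Section Real.
Variable R : realType.

(** The hypothesis says g u <= b (u+1)^(-2/3) with b^6 = B, and (u+1)^(-2/3) is at most three times
    the increment of the cube root from u to u+1. The sum telescopes to 3 b T^(1/3), and 729 =
    3^6. *)
Lemma sum_cube_root_bound (g : nat -> R) (B : R) (T : nat) :
  (forall u, 0 <= g u) -> (forall u, g u ^+ 6 * u.+1%:R ^+ 4 <= B) ->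
  (\sum_(u < T) g u) ^+ 6 <= 729 * B * T%:R ^+ 2.
Proof.
move=> g0 gB.
have B0 : 0 <= B by apply: le_trans (gB 0%N); rewrite mulr_ge0 ?exprn_ge0.
pose b := B `^ 6^-1; pose c (n : nat) := n%:R `^ 3^-1 : R.
have b0 : 0 <= b by exact: powR_ge0.
have c0 n : 0 <= c n by exact: powR_ge0.
have n6 : 6 != 0 :> R by rewrite pnatr_eq0.
have n3 : 3 != 0 :> R by rewrite pnatr_eq0.
have b6 : b ^+ 6 = B by rewrite -powR_mulrn// -powRrM mulVf// powRr1.
have c3 n : c n ^+ 3 = n%:R by rewrite -powR_mulrn// -powRrM mulVf// powRr1.
have step u : g u <= 3 * b * (c u.+1 - c u).
  have cc : c u <= c u.+1.
    by rewrite -(@ler_pXn2r _ 3)// ?nnegrE// !c3 ler_nat.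
  have h : g u * c u.+1 ^+ 2 <= b.
    rewrite -(@ler_pXn2r _ 6)// ?nnegrE ?mulr_ge0 ?exprn_ge0// b6 exprMn -exprM.
    by rewrite -[(2 * 6)%N]/(3 * 4)%N exprM c3.
  (* With x, y the cube roots of u, u+1: 1 = y^3 - x^3 = (y - x)(y^2 + y x + x^2) <= 3 y^2 (y -
     x). *)
  have e : 1 <= 3 * c u.+1 ^+ 2 * (c u.+1 - c u).
    have : 1 = c u.+1 ^+ 3 - c u ^+ 3 by rewrite !c3 -natr1; ring.
    have := c0 u; have := c0 u.+1; move: cc; move: (c u) (c u.+1) => x y xy y0 x0.
    have -> : y ^+ 3 - x ^+ 3 = (y - x) * (y ^+ 2 + y * x + x ^+ 2) by ring.
    move=> e1; rewrite [X in X <= _]e1 mulrC; apply: ler_wpM2r; first by rewrite subr_ge0.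
    have h1 : y * x <= y * y by rewrite ler_wpM2l.
    have h2 : x * x <= y * x by rewrite ler_wpM2r.
    by rewrite !expr2; lra.
  apply: (@le_trans _ _ (g u * (3 * c u.+1 ^+ 2 * (c u.+1 - c u)))).
    by rewrite ler_peMr.
  rewrite (_ : _ * _ = 3 * (g u * c u.+1 ^+ 2) * (c u.+1 - c u)); last by ring.
  by rewrite ler_wpM2r ?subr_ge0// ler_wpM2l.
have S : \sum_(u < T) g u <= 3 * b * c T.
  elim: T => [|T IH]; first by rewrite big_ord0 !mulr_ge0.
  by rewrite big_ord_recr /=; have := step T; lra.
have S0 : 0 <= \sum_(u < T) g u by apply: sumr_ge0.
apply: (@le_trans _ _ ((3 * b * c T) ^+ 6)).
  by rewrite ler_pXn2r// ?nnegrE// !mulr_ge0.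
rewrite !exprMn b6 (exprM (c T) 3 2) c3 (_ : 3 ^+ 6 = 729 :> R)//; ring.
Qed.

(** The increment 1/(n+1) is controlled by ln(1 - 1/(n+1)) <= -1/(n+1). *)
Lemma harmonic_le (t : nat) : (0 < t)%N -> \sum_(v < t) v.+1%:R^-1 <= 1 + ln (t%:R : R).
Proof.
elim: t => // t IH _; case: t IH => [|t] IH; first by rewrite big_ord1 invr1 ln1 addr0.
rewrite big_ord_recr /=; apply: (le_trans (lerD (IH isT) (lexx _))).
rewrite -addrA lerD2l.
have n0 : t.+2%:R != 0 :> R by rewrite pnatr_eq0.
have h : -1 < - t.+2%:R^-1 :> R by rewrite ltrN2 invf_lt1// ltr1n.
have := le_ln1Dx h.
have -> : 1 + - t.+2%:R^-1 = t.+1%:R / t.+2%:R :> R.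
  by rewrite -[in RHS](addrK 1 t.+1%:R) natr1 mulrBl divff// mul1r.
rewrite ln_div ?posrE ?ltr0n//.
by move: (ln _) (ln _) (_^-1) => x y z; lra.
Qed.

Lemma ln_nat_ge (t : nat) : (1 < t)%N -> 1 / 2 <= ln (t%:R : R).
Proof.
move=> t1; have h : -1 < - 2^-1 :> R by rewrite ltrN2 invf_lt1// ltr1n.
have := le_ln1Dx h; have -> : 1 + - 2^-1 = 2^-1 :> R by field.
rewrite lnV ?posrE// lerN2 => l2; rewrite div1r (le_trans l2)//.
by rewrite ler_ln ?posrE ?ltr0n ?(ltnW t1)// ler_nat.
Qed.

End Real.

Ltac pos := by apply/ltW; rewrite ?(mulr_gt0, exprn_gt0, invr_gt0, divr_gt0).

Lemma nat_above (R : realType) (x : R) : 0 <= x ->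
  exists T : nat, [/\ (0 < T)%N, x <= T%:R & T%:R <= x + 1].
Proof.
move=> x0; exists (Num.truncn x).+1; have /andP[h1 h2] := truncn_itv x0; split=> //.
  exact: ltW.
by rewrite -natr1 lerD2r.
Qed.

(** Here a, P, s, L, E stand for |A|, p, |2A|, log |A| and the energy, Tm for [low_sum], E3 for the
    third moment of [reps], and Y for the sum of cubed fibers over [rich]. A cut-off of order sqrt a
    first gives E << a^(5/2). A second one, T of order a^3 / E, brings the tail below E/4, and
    whichever other term of the decomposition reaches E/4 decides the alternative. *)
Lemma numeric_trichotomy (R : realType) (C M : R) : 0 < C -> 0 < M -> exists2 c : R, 0 < c &
  forall (a P s L E Tm E3 Y v0 : R) (hp tail : nat -> R),
  1 <= a -> 0 < P -> a <= s -> 1 / 2 <= L -> 0 < E -> 0 <= v0 -> 0 <= Y -> (forall u, 0 <= hp u) ->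
  a ^+ 3 <= C ^+ 3 * P ^+ 2 ->
  v0 <= 102 * (a ^+ 2 / P + 1) ->
  Y <= 9 * M * a ^+ 2 * L ->
  (forall T : nat, v0 <= T%:R -> (0 < T)%N -> tail T <= 3 * (M * a ^+ 3) / T%:R) ->
  (forall T : nat, v0 <= T%:R -> (0 < T)%N -> E <= a ^+ 2 + T%:R * a ^+ 2 + 3 * (M * a ^+ 3) / T%:R) ->
  E3 <= a ^+ 3 + v0 * E + 9 * M * a ^+ 3 * L ->
  a ^+ 4 * Tm ^+ 2 <= E3 * (v0 * s ^+ 2 * E) ->
  (forall u, hp u ^+ 6 * (u.+1%:R ^+ 4 * a ^+ 4) <= M * (2 * Y) ^+ 3 * (s ^+ 2 * E) ^+ 2) ->
  (forall T : nat, E <= 3 * a ^+ 2 + Tm + \sum_(u < T) hp u + tail T) ->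
  [\/ E ^+ 3 <= c * (a ^+ 4 * s ^+ 2 * Num.sqrt L ^+ 3),
      E ^+ 6 <= c * (a ^+ 8 * s ^+ 4 * L ^+ 3) |
      E <= c * (a * s ^+ 2 * P^-1 * L)].
Proof.
move=> C0 M0.
pose D : R := Num.sqrt (C ^+ 3).
have D2 : D ^+ 2 = C ^+ 3 by rewrite sqr_sqrtr// exprn_ge0// ltW.
have D0 : 0 <= D by exact: sqrtr_ge0.
clearbody D.
pose c0 : R := 102 * (D + 1).
have c0E : c0 = 102 * (D + 1) by [].
clearbody c0.
have c00 : 0 < c0 by rewrite c0E; move: D0; clear; lra.
have c01 : 0 < c0 + 1 by rewrite addr_gt0.
pose c5 : R := 3 + c0 + 3 * M.
have c5E : c5 = 3 + c0 + 3 * M by [].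
clearbody c5.
have c50 : 0 < c5 by rewrite c5E; move: c00 M0; clear; lra.
have c05 : 0 < c0 * c5 by rewrite mulr_gt0.
pose c6 : R := 2 + 2 * c0 * c5 + 9 * M.
have c6E : c6 = 2 + 2 * c0 * c5 + 9 * M by [].
clearbody c6.
have c60 : 0 < c6 by rewrite c6E; move: c05 M0; clear; lra.
have cc : 0 < c5 * (c0 + 1) by rewrite mulr_gt0.
pose K : R := 12 * M + 1 + c5 * (c0 + 1).
have KE : K = 12 * M + 1 + c5 * (c0 + 1) by [].
clearbody K.
have K0 : 0 < K by rewrite KE; move: cc M0; clear; lra.
pose k2 : R := 4 * (1632 * c6) * c5 ^+ 2.
pose k3 : R := 4 ^+ 6 * (729 * (M * (18 * M) ^+ 3) * (4 * K ^+ 2)).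
have k20 : 0 < k2 by rewrite /k2 mulr_gt0 ?exprn_gt0// mulr_gt0// mulr_gt0.
have k30 : 0 < k3 by rewrite /k3 !(mulr_gt0, exprn_gt0).
have k2E X : k2 * X = 4 * (1632 * c6) * c5 ^+ 2 * X by [].
have k3E X : k3 * X = 4 ^+ 6 * (729 * (M * (18 * M) ^+ 3) * (4 * K ^+ 2)) * X by [].
clearbody k2 k3.
pose c : R := 13824 + 2 * (1632 * c6) + k2 + k3.
have cE : c = 13824 + 2 * (1632 * c6) + k2 + k3 by [].
clearbody c.
have cpos : 0 < c by rewrite cE; move: c60 k20 k30; clear; lra.
have ck X : 0 <= X -> [/\ 13824 * X <= c * X, 2 * (1632 * c6) * X <= c * X, k2 * X <= c * X & k3 * X <= c * X].
  by move=> X0; split; apply: ler_wpM2r => //; rewrite cE; move: c60 k20 k30; clear; lra.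
exists c => //.
move=> a P s L E Tm E3 Y v0 hp tail a1 P0 as' L0 E0 v00 Y0 hp0 aP v0le Yle tailT ET E3le low hpb dec.
have a0 : 0 < a by move: a1; clear; lra.
have s0 : 0 < s by move: a0 as'; clear; lra.
have L1 : 0 < L by move: L0; clear; lra.
pose w : R := Num.sqrt a.
have w2 : w ^+ 2 = a by rewrite sqr_sqrtr// ltW.
have w0 : 0 < w by rewrite sqrtr_gt0.
clearbody w.
have w1 : 1 <= w by rewrite -(@ler_pXn2r _ 2)// ?nnegrE ?(ltW w0)// w2 expr1n.
(* The assumption a^3 <= C^3 P^2 enters here: it makes the threshold v0 of order at most sqrt a. *)
have a2P : a ^+ 2 / P <= D * w.
  have q0 : 0 <= a ^+ 2 / P by pos.
  rewrite -(@ler_pXn2r _ 2)// ?nnegrE ?(mulr_ge0 D0 (ltW w0))//.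
  rewrite (exprMn _ D w) D2 w2 expr_div_n ler_pdivrMr ?exprn_gt0//.
  have -> : (a ^+ 2) ^+ 2 = a * a ^+ 3 by ring.
  have -> : C ^+ 3 * a * P ^+ 2 = a * (C ^+ 3 * P ^+ 2) by ring.
  by apply: ler_wpM2l => //; pos.
have v0w : v0 <= c0 * w.
  apply: (le_trans v0le); rewrite c0E; move: a2P w1; clear; lra.
have cw0 : 0 <= c0 * w by pos.
have E5 : E <= c5 * w ^+ 5.
  have [|T [T0 T1 T2]] := @nat_above R (c0 * w + w); first by rewrite addr_ge0// ltW.
  have wT : w <= T%:R by move: cw0 T1; clear; lra.
  have v0T : v0 <= T%:R by move: v0w T1 w0; clear; lra.
  apply: (le_trans (ET T v0T T0)).
  have h1 : 3 * (M * a ^+ 3) / T%:R <= 3 * M * w ^+ 5.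
    rewrite ler_pdivrMr ?ltr0n//.
    have -> : 3 * (M * a ^+ 3) = 3 * M * w ^+ 5 * w by rewrite -w2; ring.
    by apply: ler_wpM2l => //; pos.
  have h2 : a ^+ 2 <= w ^+ 5 by rewrite -w2 -exprM ler_weXn2l.
  have h3 : T%:R * a ^+ 2 <= (c0 + 2) * w * a ^+ 2.
    apply: ler_wpM2r; first by pos.
    by move: T2 w1; clear; lra.
  have h4 : (c0 + 2) * w * a ^+ 2 = (c0 + 2) * w ^+ 5 by rewrite -w2; ring.
  rewrite h4 in h3; rewrite c5E; move: h1 h2 h3; clear; lra.
have w60 : 0 < w ^+ 6 by rewrite exprn_gt0.
have aw6 : a ^+ 3 = w ^+ 6 by rewrite -w2; ring.
have E36 : E3 <= c6 * (w ^+ 6 * L).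
  apply: (le_trans E3le).
  have h1 : v0 * E <= c0 * c5 * w ^+ 6.
    have -> : c0 * c5 * w ^+ 6 = (c0 * w) * (c5 * w ^+ 5) by ring.
    by apply: ler_pM => //; exact: ltW.
  have L2 : 1 <= 2 * L by move: L0; clear; lra.
  have h2 : w ^+ 6 <= 2 * (w ^+ 6 * L).
    by rewrite mulrCA ler_peMr// ltW.
  have h3 : c0 * c5 * w ^+ 6 <= c0 * c5 * (2 * (w ^+ 6 * L)).
    by apply: ler_wpM2l => //; pos.
  rewrite aw6 c6E; move: h1 h2 h3; clear; lra.
(* K exceeds 12 M, so the tail beyond x is below E/4; its summand c5 (c0 + 1), with E <= c5 w^5,
   puts x above the threshold. *)
pose x : R := K * a ^+ 3 / E.
have xE : x = K * a ^+ 3 / E by [].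
clearbody x.
have xw : (c0 + 1) * w <= x.
  rewrite xE ler_pdivlMr//; apply: (@le_trans _ _ ((c0 + 1) * w * (c5 * w ^+ 5))).
    by apply: ler_wpM2l => //; pos.
  have -> : (c0 + 1) * w * (c5 * w ^+ 5) = c5 * (c0 + 1) * w ^+ 6 by ring.
  rewrite aw6; apply: ler_wpM2r; first by pos.
  rewrite KE; move: M0; clear; lra.
have x1 : 1 <= x by move: xw cw0 w1; clear; lra.
have x0 : 0 < x by move: x1; clear; lra.
have [T [T0 T1 T2]] := nat_above (ltW x0).
have v0T : v0 <= T%:R by move: v0w xw w0 T1; clear; lra.
have tail4 : 4 * tail T < E.
  have h1 : 3 * (M * a ^+ 3) / T%:R <= 3 * (M * a ^+ 3) / x.
    apply: ler_wpM2l; first by pos.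
    by rewrite lef_pV2 ?posrE ?ltr0n.
  have h2 : 3 * (M * a ^+ 3) / x = 3 * M / K * E.
    by rewrite xE; field; rewrite !lt0r_neq0.
  have h3 : 3 * M / K * 4 < 1.
    by rewrite mulrAC ltr_pdivrMr// KE; move: M0 cc; clear; lra.
  have h4 : 4 * (3 * M / K * E) < E.
    by rewrite mulrA [4 * _]mulrC -[X in _ < X]mul1r ltr_pM2r.
  have tl := le_trans (tailT T v0T T0) h1; rewrite h2 in tl.
  move: tl h4; clear; lra.
have decT := dec T.
pose l : R := Num.sqrt L.
have l2 : l ^+ 2 = L by rewrite sqr_sqrtr// ltW.
have l0 : 0 < l by rewrite sqrtr_gt0.
rewrite -/l; clearbody l.
have half0 : 0 <= 1 / 2 :> R by rewrite divr_ge0.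
have lh : 1 / 2 <= l.
  rewrite -(@ler_pXn2r _ 2)// ?nnegrE ?(ltW l0) ?half0// l2.
  by apply: (le_trans _ L0); clear; lra.
have T10 : 0 <= a ^+ 4 * s ^+ 2 * l ^+ 3 by pos.
have [h12|h12] := leP E (12 * a ^+ 2).
  constructor 1.
  have h1 : E ^+ 3 <= (12 * a ^+ 2) ^+ 3.
    by rewrite ler_pXn2r// nnegrE ltW// (lt_le_trans E0).
  have h2 : (12 * a ^+ 2) ^+ 3 = 1728 * (a ^+ 4 * a ^+ 2) by ring.
  have h3 : a ^+ 4 * a ^+ 2 <= a ^+ 4 * s ^+ 2.
    apply: ler_wpM2l; first by pos.
    by rewrite ler_pXn2r// nnegrE ltW.
  have h4 : 1 <= 8 * l ^+ 3.
    have h : (1 / 2) ^+ 3 <= l ^+ 3 by rewrite ler_pXn2r// ?nnegrE ?half0 ?(ltW l0).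
    move: h; clear; lra.
  have h5 : a ^+ 4 * s ^+ 2 <= 8 * (a ^+ 4 * s ^+ 2 * l ^+ 3).
    have -> : 8 * (a ^+ 4 * s ^+ 2 * l ^+ 3) = a ^+ 4 * s ^+ 2 * (8 * l ^+ 3) by ring.
    by apply: ler_peMr => //; pos.
  apply: (@le_trans _ _ (13824 * (a ^+ 4 * s ^+ 2 * l ^+ 3))).
    rewrite h2 in h1; move: h1 h3 h5; clear; lra.
  by have [] := ck _ T10.
have [h4T|h4T] := leP E (4 * Tm).
  have Tm0 : 0 < Tm by move: h4T E0; clear; lra.
  have h1 : E ^+ 2 <= 16 * Tm ^+ 2.
    have -> : 16 * Tm ^+ 2 = (4 * Tm) ^+ 2 by ring.
    by rewrite ler_pXn2r// nnegrE ltW// (lt_le_trans E0).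
  (* One factor E cancels between E^2 <= 16 Tm^2 and the bound on Tm^2, and E3 << a^3 L; 1632 = 16 *
     102. *)
  have h2 : a * E <= 1632 * c6 * L * s ^+ 2 * (a ^+ 2 / P + 1).
    have w8 : 0 < a ^+ 3 * E by rewrite mulr_gt0// exprn_gt0.
    rewrite -(ler_pM2l w8).
    apply: (@le_trans _ _ (16 * (a ^+ 4 * Tm ^+ 2))).
      have -> : a ^+ 3 * E * (a * E) = a ^+ 4 * E ^+ 2 by ring.
      have -> : 16 * (a ^+ 4 * Tm ^+ 2) = a ^+ 4 * (16 * Tm ^+ 2) by ring.
      by apply: ler_wpM2l => //; pos.
    apply: (@le_trans _ _ (16 * (c6 * (w ^+ 6 * L) * (v0 * s ^+ 2 * E)))).
      apply: ler_wpM2l => //; apply: (le_trans low); apply: ler_wpM2r => //.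
      apply: mulr_ge0; last exact: ltW.
      by apply: mulr_ge0 => //; pos.
    rewrite -aw6.
    have -> : 16 * (c6 * (a ^+ 3 * L) * (v0 * s ^+ 2 * E)) =
      (16 * (a ^+ 3 * E) * c6 * L * s ^+ 2) * v0 by ring.
    have -> : a ^+ 3 * E * (1632 * c6 * L * s ^+ 2 * (a ^+ 2 / P + 1)) =
      (16 * (a ^+ 3 * E) * c6 * L * s ^+ 2) * (102 * (a ^+ 2 / P + 1)) by ring.
    by apply: ler_wpM2l => //; pos.
  have X0 : 0 <= 1632 * c6 * L * s ^+ 2 by pos.
  (* If a^2 >= P, the threshold is of order a^2 / P, which gives the second term of the maximum.
     Otherwise it is bounded, so a E << L s^2, and multiplying by E^2 << a^5 gives the first
     term. *)
  have [hP|hP] := leP 1 (a ^+ 2 / P).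
    constructor 3.
    have h3 : a * E <= a * (2 * (1632 * c6) * (a * s ^+ 2 * P^-1 * L)).
      apply: (le_trans h2).
      have -> : a * (2 * (1632 * c6) * (a * s ^+ 2 * P^-1 * L)) =
        1632 * c6 * L * s ^+ 2 * (2 * (a ^+ 2 / P)) by ring.
      apply: ler_wpM2l => //; move: hP; clear; lra.
    rewrite ler_pM2l// in h3; apply: (le_trans h3).
    have X0' : 0 <= a * s ^+ 2 * P^-1 * L by pos.
    by have [] := ck _ X0'.
  constructor 1.
  have h3 : a * E <= 2 * (1632 * c6) * L * s ^+ 2.
    apply: (le_trans h2).
    have -> : 2 * (1632 * c6) * L * s ^+ 2 = 1632 * c6 * L * s ^+ 2 * 2 by ring.
    apply: ler_wpM2l => //; move: hP; clear; lra.
  have h4 : E ^+ 2 <= c5 ^+ 2 * a ^+ 5.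
    have -> : c5 ^+ 2 * a ^+ 5 = (c5 * w ^+ 5) ^+ 2 by rewrite -w2; ring.
    by rewrite ler_pXn2r// nnegrE ltW// (lt_le_trans E0).
  have h5 : a * E ^+ 3 <= a * (k2 * (a ^+ 4 * s ^+ 2 * l ^+ 3)).
    have -> : a * E ^+ 3 = (a * E) * E ^+ 2 by ring.
    apply: (@le_trans _ _ ((2 * (1632 * c6) * L * s ^+ 2) * (c5 ^+ 2 * a ^+ 5))).
      by apply: ler_pM => //; pos.
    have -> : a * (k2 * (a ^+ 4 * s ^+ 2 * l ^+ 3)) =
      ((2 * (1632 * c6) * l ^+ 2 * s ^+ 2) * (c5 ^+ 2 * a ^+ 5)) * (2 * l) by rewrite k2E; ring.
    rewrite l2; apply: ler_peMr; first by pos.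
    by move: lh; clear; lra.
  rewrite ler_pM2l// in h5; apply: (le_trans h5).
  by have [] := ck _ T10.
constructor 2.
have h4B : E <= 4 * \sum_(u < T) hp u.
  by move: decT h12 h4T tail4; move: (\sum_(u < T) hp u) (tail T) => S t; clear; lra.
pose B0 : R := M * (2 * Y) ^+ 3 * (s ^+ 2 * E) ^+ 2 / a ^+ 4.
have B0E : B0 = M * (2 * Y) ^+ 3 * (s ^+ 2 * E) ^+ 2 / a ^+ 4 by [].
clearbody B0.
have B0b u : hp u ^+ 6 * u.+1%:R ^+ 4 <= B0.
  rewrite B0E ler_pdivlMr ?exprn_gt0//; apply: le_trans (hpb u).
  by rewrite [X in _ <= X]mulrA.
have B00 : 0 <= B0.
  by apply: le_trans (B0b 0%N); rewrite mulr_ge0 ?exprn_ge0.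
have S6 := sum_cube_root_bound T hp0 B0b.
have E6 : E ^+ 6 <= 4 ^+ 6 * (729 * B0 * T%:R ^+ 2).
  apply: (@le_trans _ _ ((4 * \sum_(u < T) hp u) ^+ 6)).
    by rewrite ler_pXn2r// nnegrE ltW// (lt_le_trans E0).
  by rewrite exprMn; apply: ler_wpM2l => //; exact: exprn_ge0.
have B0le : B0 <= M * (18 * M) ^+ 3 * (a ^+ 2 * L ^+ 3 * s ^+ 4 * E ^+ 2).
  rewrite B0E ler_pdivrMr ?exprn_gt0//.
  have h : (2 * Y) ^+ 3 <= (18 * M * a ^+ 2 * L) ^+ 3.
    rewrite ler_pXn2r// ?nnegrE; [|exact: mulr_ge0|pos].
    move: Yle; clear; lra.
  apply: (@le_trans _ _ (M * (18 * M * a ^+ 2 * L) ^+ 3 * (s ^+ 2 * E) ^+ 2)).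
    apply: ler_wpM2r; first by pos.
    by apply: ler_wpM2l => //; pos.
  by rewrite le_eqVlt; apply/orP; left; apply/eqP; ring.
have T2x : T%:R ^+ 2 <= 4 * K ^+ 2 * (a ^+ 6 / E ^+ 2).
  have -> : 4 * K ^+ 2 * (a ^+ 6 / E ^+ 2) = (2 * x) ^+ 2.
    by rewrite xE; field; rewrite lt0r_neq0.
  rewrite ler_pXn2r// ?nnegrE//; first by move: T2 x1; clear; lra.
  by pos.
have Big0 : 0 <= a ^+ 8 * s ^+ 4 * L ^+ 3 by pos.
apply: (@le_trans _ _ (k3 * (a ^+ 8 * s ^+ 4 * L ^+ 3))); last by have [] := ck _ Big0.
(* The energy cancels: B0 carries E^2, while T^2 carries a^6 / E^2. *)
apply: (le_trans E6).
have -> : k3 * (a ^+ 8 * s ^+ 4 * L ^+ 3) = 4 ^+ 6 * (729 *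
   (M * (18 * M) ^+ 3 * (a ^+ 2 * L ^+ 3 * s ^+ 4 * E ^+ 2)) * (4 * K ^+ 2 * (a ^+ 6 / E ^+ 2))).
  by rewrite k3E; field; rewrite lt0r_neq0.
apply: ler_wpM2l; first exact: exprn_ge0.
apply: ler_pM => //; [by apply: mulr_ge0|exact: exprn_ge0|].
exact: ler_wpM2l.
Qed.

(** * Moments of the representation function *)

Section RealCounting.
Variables (R : realType) (F : finFieldType) (t : nat) (A : {set F}).
Hypothesis t0 : (0 < t)%N.
Hypothesis memA : forall x, (x \in A) = (x ^+ t == 1).
Hypothesis cardA : #|A| = t.
Variable v0 : nat.
Hypothesis rich_points_over : forall K : {set F * F}, K \subset rich F t v0 ->
  (#|points_over t K| ^ 3 <= 125 * 256 * (#|K| * t) ^ 2)%N.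

Notation fiber := (@fiber F t).
Notation reps := (@reps F A).
Let a : R := t%:R.
Let M : R := (125 * 256)%:R.

Lemma reps_le d : (reps d <= t)%N.
Proof. by rewrite -cardA; apply/subset_leq_card/subsetP => y; rewrite inE => /andP[]. Qed.

Lemma sum_reps_total : (\sum_d reps d = t ^ 2)%N.
Proof.
have := sum_reps A (fun _ => 1%N).
under [RHS]eq_bigr => d _ do rewrite muln1.
by move=> <-; rewrite !sum_nat_const muln1 cardA mulnn.
Qed.

Lemma sum_rich_cube :
  (\sum_(k in rich F t v0) fiber k ^ 3)%N%:R <= 3 * (M * a ^+ 2) * \sum_(v < t) v.+1%:R^-1 :> R.
Proof.
rewrite natr_sum; under eq_bigr do rewrite natrX.
apply: sum_cube_levels => [k _|v _]; first exact: fiber_le.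
by rewrite -!natrX -!natrM ler_nat rich_level.
Qed.

Let reps_levels v : (0 < v)%N ->
  v%:R ^+ 3 * #|[set d in rich_reps A v0 | (v <= reps d)%N]|%:R <= M * a ^+ 3.
Proof. by move=> _; rewrite -!natrX -!natrM ler_nat (rich_reps_level t0 memA). Qed.

Lemma sum_rich_reps_cube :
  (\sum_(d in rich_reps A v0) reps d ^ 3)%N%:R <= 3 * (M * a ^+ 3) * \sum_(v < t) v.+1%:R^-1 :> R.
Proof.
rewrite natr_sum; under eq_bigr do rewrite natrX.
by apply: sum_cube_levels => [d _|]; [exact: reps_le|exact: reps_levels].
Qed.

Lemma sum_reps_sqr_tail T : (v0 <= T)%N -> (0 < T)%N ->
  (\sum_(d | (d != 0%R) && (T <= reps d)) reps d ^ 2)%N%:R <= 3 * (M * a ^+ 3) / T%:R :> R.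
Proof.
move=> vT T0; rewrite natr_sum; under eq_bigr do rewrite natrX.
have -> : \sum_(d | (d != 0) && (T <= reps d)%N) (reps d)%:R ^+ 2 =
    \sum_(d in rich_reps A v0 | (T <= reps d)%N) (reps d)%:R ^+ 2 :> R.
  apply: eq_bigl => d; rewrite inE; case: (d != 0) => //=.
  by apply/idP/andP => [h|[]//]; rewrite h (leq_trans vT h).
apply: (@sum_sqr_levels R F (rich_reps A v0) reps t) => // d _; exact: reps_le.
Qed.

(** The difference 0 gives a^2; values of [reps] below T contribute at most T times their total a^2;
    the rest is the tail. *)
Lemma energy_le_levels T : (v0 <= T)%N -> (0 < T)%N ->
  (additive_energy A)%:R <= a ^+ 2 + T%:R * a ^+ 2 + 3 * (M * a ^+ 3) / T%:R.
Proof.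
move=> vT T0; rewrite (energy_sum_sqr cardA) natrD natrX -addrA lerD2l.
apply: le_trans (lerD (lexx _) (sum_reps_sqr_tail vT T0)).
rewrite -natrX -natrM -natrD ler_nat.
rewrite (bigID (fun d => (T <= reps d)%N)) /= addnC leq_add2r.
rewrite -sum_reps_total big_distrr /= [X in (_ <= X)%N](bigID (fun d => (d != 0%R) && ~~ (T <= reps d)%N)) /=.
rewrite (leq_trans _ (leq_addr _ _))//; apply: leq_sum => d /andP[_]; rewrite -ltnNge => /ltnW h.
by rewrite -mulnn leq_mul2r h orbT.
Qed.

(** Nonzero differences below the threshold are absorbed by v0 times the energy; only the rich ones
    need the level-set bound. *)
Lemma sum_reps_cube :
  (\sum_d reps d ^ 3)%N%:R <= a ^+ 3 + v0%:R * (additive_energy A)%:R +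
     3 * (M * a ^+ 3) * \sum_(v < t) v.+1%:R^-1 :> R.
Proof.
apply: le_trans (lerD (lexx _) sum_rich_reps_cube).
rewrite -natrX -natrM -!natrD ler_nat (bigD1 0)//= (reps0 cardA) -addnA leq_add2l.
rewrite (bigID (mem (rich_reps A v0))) /= addnC leq_add//.
  rewrite (energy_sum_sqr cardA) mulnDr (leq_trans _ (leq_addl _ _))// big_distrr /=.
  rewrite [X in (_ <= X)%N](bigID (mem (rich_reps A v0))) /= (leq_trans _ (leq_addl _ _))//.
  apply: leq_sum => d /andP[d0]; rewrite inE d0 /= -ltnNge => /ltnW h.
  by rewrite expnS leq_mul2r h orbT.
rewrite [X in (X <= _)%N](eq_bigl (mem (rich_reps A v0)))// => d.
by rewrite andb_idl// inE => /andP[].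
Qed.

End RealCounting.

(** * From subgroups of the unit group to the final estimate *)

(** The |A| elements are roots of X^|A| - 1, which has no more than |A| roots. *)
Lemma mem_subgroup_set (F : finFieldType) (A : {group {unit F}}) (x : F) :
  (x \in subgroup_set A) = (x ^+ #|A| == 1).
Proof.
have cS : #|subgroup_set A| = #|A| by rewrite card_imset//; exact: val_inj.
suff -> : subgroup_set A = [set y | y ^+ #|A| == 1] by rewrite inE.
apply/eqP; rewrite eqEcard cS card_roots_le ?cardG_gt0// andbT.
apply/subsetP => _ /imsetP[u uA ->].
by rewrite inE -FinRing.val_unitX (expg_cardG uA) FinRing.val_unit1.
Qed.

Lemma leq_card_sumset (F : finFieldType) (S : {set F}) : (#|S| <= #|sumset S S|)%N.
Proof.
have [->|[y yS]] := set_0Vmem S; first by rewrite cards0.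
rewrite -[X in (X <= _)%N](card_imset _ (addIr y)); apply/subset_leq_card/subsetP => _ /imsetP[x xS ->].
by apply/imset2P; exists x y.
Qed.

(* The first two alternatives bound E by the first term of the maximum; they are stated
   for E^3 and E^6 to avoid fractional exponents. *)
Lemma energy_trichotomy (R : realType) (C : R) : 0 < C -> exists2 c : R, 0 < c &
  forall (F : finFieldType) (p t : nat) (A : {set F}),
  prime p -> p \in [pchar F] -> (forall x, (x \in A) = (x ^+ t == 1)) -> #|A| = t ->
  (1 < t)%N -> 4 + 256 * C ^+ 9 <= t%:R -> t%:R ^+ 3 <= C ^+ 3 * p%:R ^+ 2 ->
  let a : R := t%:R in let s : R := #|sumset A A|%:R in
  let E : R := (additive_energy A)%:R in let L : R := ln a in
  [\/ E ^+ 3 <= c * (a ^+ 4 * s ^+ 2 * Num.sqrt L ^+ 3),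
      E ^+ 6 <= c * (a ^+ 8 * s ^+ 4 * L ^+ 3) |
      E <= c * (a * s ^+ 2 * p%:R^-1 * L)].
Proof.
move=> C0; pose M : R := (125 * 256)%:R.
have M0 : 0 < M by rewrite ltr0n.
have [c c0 core] := numeric_trichotomy C0 M0; exists c => //.
move=> F p t A pp charF memA cardA t1 tbig tp a s E L.
have t0 : (0 < t)%N by exact: ltnW.
have p0 : (0 < p)%N by exact: prime_gt0.
have C9 : 0 < C ^+ 9 by rewrite exprn_gt0.
have a0 : 0 < a by rewrite ltr0n.
have P0 : 0 < p%:R :> R by rewrite ltr0n.
have t4 : (4 <= t)%N by rewrite -(ler_nat R); move: tbig C9; clear; lra.
(* After squaring and multiplying by C^9, this follows from t^9 <= C^9 p^6 and t >= 256 C^9. *)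
have tp4 : (16 * t ^ 4 <= p ^ 3)%N.
  rewrite -(ler_nat R) natrM !natrX -/a -(@ler_pXn2r _ 2)// ?nnegrE ?exprn_ge0 ?mulr_ge0 ?exprn_ge0//.
  rewrite -(ler_pM2l C9).
  have h1 : (a ^+ 3) ^+ 3 <= (C ^+ 3 * p%:R ^+ 2) ^+ 3.
    by rewrite ler_pXn2r// ?nnegrE ?exprn_ge0// mulr_ge0 ?exprn_ge0// ltW.
  have -> : C ^+ 9 * (p%:R ^+ 3) ^+ 2 = (C ^+ 3 * p%:R ^+ 2) ^+ 3 :> R by ring.
  apply: le_trans h1.
  have -> : C ^+ 9 * (16 * a ^+ 4) ^+ 2 = (256 * C ^+ 9) * a ^+ 8 by ring.
  have -> : (a ^+ 3) ^+ 3 = a * a ^+ 8 by ring.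
  by apply: ler_wpM2r; [pos|move: tbig; rewrite -/a; clear; lra].
have [k0t k0p v0k] := stepanov_params t4 p0 tp4.
set v0 := (102 * (t ^ 2 %/ p + 1))%N in v0k.
have gp := fun K => @rich_points_over_bound F t t0 v0 p _ K charF k0t k0p v0k.
have L0 : 1 / 2 <= L by exact: ln_nat_ge.
have H3 : \sum_(v < t) v.+1%:R^-1 <= 3 * L.
  apply: (le_trans (harmonic_le R t0)); rewrite -/a -/L; move: L0; clear; lra.
pose Y : R := (\sum_(k in rich F t v0) fiber t k ^ 3)%N%:R.
pose hp u : R := #|high_pairs t A v0 u.+1|%:R.
pose tail T : R := (\sum_(d : F | (d != 0%R) && (T <= reps A d)) reps A d ^ 2)%N%:R.
pose E3 : R := (\sum_d reps A d ^ 3)%N%:R.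
pose E' := (\sum_(d : F | d != 0%R) reps A d ^ 2)%N.
have EE : additive_energy A = (t ^ 2 + E')%N by exact: energy_sum_sqr.
have E'E : E'%:R <= E by rewrite ler_nat EE leq_addl.
apply: (core a p%:R s L E (low_sum t A v0)%:R E3 Y v0%:R hp tail) => //.
- by rewrite ler1n.
- by rewrite ler_nat -cardA leq_card_sumset.
- by rewrite ltr0n EE addn_gt0 expn_gt0 t0.
- rewrite natrM ler_wpM2l// natrD lerD2r ler_pdivlMr// -natrX -natrM ler_nat.
  exact: leq_trunc_div.
- apply: (le_trans (sum_rich_cube R t0 gp)).
  have -> : 9 * M * a ^+ 2 * L = 3 * (M * a ^+ 2) * (3 * L) by ring.
  by apply: ler_wpM2l => //; pos.
- move=> T; rewrite ler_nat => vT T0.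
  exact: (sum_reps_sqr_tail R t0 memA cardA gp).
- move=> T; rewrite ler_nat => vT T0.
  exact: (energy_le_levels R t0 memA cardA gp).
- apply: (le_trans (sum_reps_cube R t0 memA cardA gp)).
  rewrite lerD2l (_ : 9 * M * a ^+ 3 * L = 3 * (M * a ^+ 3) * (3 * L)); last by ring.
  by apply: ler_wpM2l => //; pos.
- apply: (@le_trans _ _ (E3 * (v0%:R * s ^+ 2 * E'%:R))).
    by rewrite -!natrX -!natrM ler_nat (low_energy t0 memA cardA).
  by apply: ler_wpM2l => //; apply: ler_wpM2l => //; rewrite mulr_ge0// exprn_ge0.
- move=> u; apply: (@le_trans _ _ (M * (2 * Y) ^+ 3 * (s ^+ 2 * E'%:R) ^+ 2)).
    rewrite -!natrX -!natrM -!natrX -!natrM ler_nat.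
    exact: (high_pairs_bound t0 memA cardA gp).
  apply: ler_wpM2l; first by rewrite mulr_ge0// exprn_ge0// mulr_ge0.
  have s20 : 0 <= s ^+ 2 by exact: exprn_ge0.
  by rewrite ler_pXn2r ?nnegrE ?mulr_ge0//; apply: ler_wpM2l.
- move=> T; rewrite /tail /hp -natr_sum -natrX -natrM -!natrD ler_nat.
  exact: energy_decomposition.
Qed.

(** Since c <= 1 + c <= (1 + c)^(n+1), no root of c has to be taken. *)
Lemma ler_of_expr_le (R : realType) (n : nat) (c x y : R) : 0 < c -> 0 <= x -> 0 <= y ->
  x ^+ n.+1 <= c * y ^+ n.+1 -> x <= (1 + c) * y.
Proof.
move=> c0 x0 y0 h; rewrite -(@ler_pXn2r _ n.+1)// ?nnegrE//; last first.
  by rewrite mulr_ge0// addr_ge0// ltW.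
apply: (le_trans h); rewrite exprMn ler_wpM2r ?exprn_ge0//.
apply: (@le_trans _ _ (1 + c)); first by rewrite lerDr.
by rewrite ler_eXnr// lerDl ltW.
Qed.

(** For |A| = 1 the energy is 1 while log |A| = 0 makes both terms vanish, hence the assumption 1 <
    |A|. *)
Theorem theorem9 (R : realType) :
  forall C : R, 0 < C ->
  exists C' : R, 0 < C' /\
    forall (p : nat) (A : {group {unit 'F_p}}),
      prime p ->
      (1 < #|A|)%N ->
      #|A|%:R <= C * p%:R `^ (2 / 3) ->
      let S := subgroup_set A in
      let a : R := #|A|%:R in
      let s : R := #|sumset S S|%:R in
      (additive_energy S)%:R <=
        C' * Num.max (a `^ (4 / 3) * s `^ (2 / 3) * ln a `^ (1 / 2))
                     (a * s ^+ 2 * p%:R^-1 * ln a).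
Proof.
move=> C C0; have [c c0 dich] := energy_trichotomy C0.
pose N : R := 4 + 256 * C ^+ 9.
have N0 : 0 < N by rewrite addr_gt0// mulr_gt0// exprn_gt0.
have N3 : 0 < N ^+ 3 by rewrite exprn_gt0.
exists (1 + c + 2 * N ^+ 3); split; first by move: c0 N3; clear; lra.
move=> p A pp t1 ap; cbv zeta.
set S := subgroup_set A; set a : R := #|A|%:R; set s : R := #|sumset S S|%:R.
set E : R := (additive_energy S)%:R.
set T1 := a `^ _ * _ * _; set T2 := a * _ * _ * _.
have cS : #|S| = #|A| by rewrite card_imset//; exact: val_inj.
have a1 : 1 <= a by rewrite ler1n ltnW.
have as' : a <= s by rewrite ler_nat -cS leq_card_sumset.
have a0 : 0 <= a by [].
have s0 : 0 <= s by [].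
have L0 : 1 / 2 <= ln a by exact: ln_nat_ge.
have L1 : 0 <= ln a by move: L0; clear; lra.
have T10 : 0 <= T1 by rewrite !mulr_ge0// powR_ge0.
have T1max : T1 <= Num.max T1 T2 by rewrite le_max lexx.
have T2max : T2 <= Num.max T1 T2 by rewrite le_max lexx orbT.
have E0 : 0 <= E by [].
have n3 : 3 != 0 :> R by rewrite pnatr_eq0.
have pow_third (x : R) (n : nat) : 0 <= x -> (x `^ (n%:R / 3)) ^+ 3 = x ^+ n.
  by move=> x0; rewrite -powR_mulrn ?powR_ge0// -powRrM divfK// powR_mulrn.
have T1E : T1 = a `^ (4 / 3) * s `^ (2 / 3) * Num.sqrt (ln a).
  by rewrite /T1 div1r powR12_sqrt.
have T13 : T1 ^+ 3 = a ^+ 4 * s ^+ 2 * Num.sqrt (ln a) ^+ 3.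
  by rewrite T1E !exprMn !pow_third.
have T16 : T1 ^+ 6 = a ^+ 8 * s ^+ 4 * ln a ^+ 3.
  rewrite (exprM T1 3 2) T13 -[in RHS](sqr_sqrtr L1); move: (Num.sqrt _) => l; ring.
suff [h|h] : E <= (1 + c + 2 * N ^+ 3) * T1 \/ E <= (1 + c + 2 * N ^+ 3) * T2.
- by apply: (le_trans h); apply: ler_wpM2l => //; move: c0 N3; clear; lra.
- by apply: (le_trans h); apply: ler_wpM2l => //; move: c0 N3; clear; lra.
(* Below N the trivial bound E <= a^3 <= N^3 suffices: the first term is at least 1/2, which
   accounts for 2 N^3 in the constant. *)
have [big|small] := leP N a; last first.
  left; have Ea : E <= a ^+ 3.
    rewrite -natrX ler_nat (energyE S) -cS.
    apply: (@leq_trans (\sum_(x in S) \sum_(z in S) #|S|)%N).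
      apply: leq_sum => x _; apply: leq_sum => z _.
      by apply/subset_leq_card/subsetP => y; rewrite inE => /andP[].
    by rewrite !sum_nat_const !expnS expn0 muln1.
  have aN : a ^+ 3 <= N ^+ 3 by rewrite ler_pXn2r// ?nnegrE ltW.
  have half0 : 0 <= 1 / 2 :> R by rewrite divr_ge0.
  have T1half : 1 / 2 <= T1.
    rewrite -(@ler_pXn2r _ 6)// ?nnegrE ?half0// T16.
    have h1 : (1 / 2) ^+ 3 <= ln a ^+ 3 by rewrite ler_pXn2r// ?nnegrE ?half0.
    have h2 : 1 <= a ^+ 8 * s ^+ 4 by rewrite mulr_ege1// exprn_ege1// (le_trans a1).
    apply: (@le_trans _ _ (1 * (1 / 2) ^+ 3)); first by clear; lra.
    by apply: ler_pM => //; rewrite exprn_ge0.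
  apply: (@le_trans _ _ (2 * N ^+ 3 * T1)).
    by move: Ea aN T1half N3; move: (N ^+ 3) (a ^+ 3) => u v; clear; nra.
  by apply: ler_wpM2r => //; move: c0; clear; lra.
have charF : p \in [pchar 'F_p] by exact: pchar_Fp.
have ap3 : a ^+ 3 <= C ^+ 3 * p%:R ^+ 2.
  have P0 : 0 <= p%:R :> R by [].
  rewrite -(pow_third p%:R 2 P0) -exprMn ler_pXn2r// nnegrE.
  by rewrite mulr_ge0 ?powR_ge0// ltW.
have cc : 1 + c <= 1 + c + 2 * N ^+ 3 by move: N3; clear; lra.
have [h|h|h] := dich _ p _ S pp charF (mem_subgroup_set A) cS t1 big ap3.
- left; rewrite -T13 in h.
  by apply: (le_trans (ler_of_expr_le c0 E0 T10 h)); apply: ler_wpM2r.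
- left; rewrite -T16 in h.
  by apply: (le_trans (ler_of_expr_le c0 E0 T10 h)); apply: ler_wpM2r.
- right; apply: (le_trans h); apply: ler_wpM2r; last by move: N3; clear; lra.
  by rewrite !(mulr_ge0, exprn_ge0)// invr_ge0.
Qed.
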